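(* Let $A$ and $B$ be unital $C^*$-algebras and suppose that $T\colon A_{++}\to B_{++}$ is a bijection. Then $T$ satisfies $$\|T(a+b)\|=\|T(a)+T(b)\|$$ for every pair $a,b\in A_{++}$ if and only if there is a Jordan $*$-isomorphism $J\colon A\to B$ such that $T(a)=T(e)^{\frac12} J(a)\,T(e)^{\frac12}$ for every $a\in A_{++}$.
   Context: The unit of any unital $C^*$-algebra is denoted by $e$. For a unital $C^*$-algebra $A$, $A_+=\{a\in A: a=a^*,\ 0\le a\}$ is the positive semidefinite cone and $A_{++}=\{a\in A_+: a \text{ is invertible in } A\}$ is the positive definite cone. A Jordan $*$-isomorphism $J\colon A\to B$ is a complex-linear bijection with $J(a^2)=J(a)^2$ and $J(a^* )=J(a)^*$ for all $a\in A$. *)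

(* Defs.v *)
From HB Require Import structures.
From mathcomp Require Import all_boot all_order all_algebra.
From mathcomp Require Import complex.
From mathcomp Require Import boolp classical_sets functions reals.
From mathcomp Require Import topology normedtype.

Set Implicit Arguments.
Unset Strict Implicit.
Unset Printing Implicit Defensive.

Import Order.TTheory GRing.Theory Num.Theory.
Import numFieldNormedType.Exports.

Local Open Scope classical_set_scope.
Local Open Scope complex_scope.
Local Open Scope ring_scope.

(* Unital complex C*-algebras, the zero algebra included.  The product is a field
   of the mixin because Hierarchy Builder accepts no structure joining rings and
   normed modules other than numDomainType; the ring structure of the library is
   recovered below, so that the usual notations can be used.  The norm takes its
   values in R[i], as for every normed module over R[i]; these values are
   nonnegative reals. *)
HB.mixin Record isUnitalCStarAlgebra (R : realType) A
    & CompleteNormedModule R[i] A := {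
  cstar_one : A;
  cstar_mul : A -> A -> A;
  star : A -> A;
  cstar_mulA : associative cstar_mul;
  cstar_mul1l : left_id cstar_one cstar_mul;
  cstar_mul1r : right_id cstar_one cstar_mul;
  cstar_mulDl : left_distributive cstar_mul +%R;
  cstar_mulDr : right_distributive cstar_mul +%R;
  cstar_scaleAl : forall (l : R[i]) (a b : A),
    l *: cstar_mul a b = cstar_mul (l *: a) b;
  cstar_scaleAr : forall (l : R[i]) (a b : A),
    l *: cstar_mul a b = cstar_mul a (l *: b);
  cstar_normM : forall a b : A, `|cstar_mul a b| <= `|a| * `|b|;
  starK : forall a : A, star (star a) = a;
  starD : forall a b : A, star (a + b) = star a + star b;
  starZ : forall (l : R[i]) (a : A), star (l *: a) = l^* *: star a;
  starM : forall a b : A, star (cstar_mul a b) = cstar_mul (star b) (star a);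
  cstar_identity : forall a : A, `|cstar_mul (star a) a| = `|a| ^+ 2
}.

#[short(type="unitalCStarAlgType")]
HB.structure Definition UnitalCStarAlgebra (R : realType) :=
  {A of CompleteNormedModule R[i] A & isUnitalCStarAlgebra R A}.

HB.instance Definition _ (R : realType) (A : unitalCStarAlgType R) :=
  GRing.Zmodule_isPzRing.Build (UnitalCStarAlgebra.sort A)
    (@cstar_mulA R A) (@cstar_mul1l R A) (@cstar_mul1r R A)
    (@cstar_mulDl R A) (@cstar_mulDr R A).

Section CStarAlgebra.
Variables (R : realType) (A : unitalCStarAlgType R).
Implicit Types a b s : A.

Definition invertible a := exists b, a * b = 1 /\ b * a = 1.

Definition spectrum a : set R[i] := [set l : R[i] | ~ invertible (a - l *: (1 : A))].

(* In R[i], 0 <= l means that l is real and nonnegative. *)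
Definition positive_cone : set A :=
  [set a | a = star a /\ spectrum a `<=` [set l : R[i] | 0 <= l]].

Definition positive_definite_cone : set A :=
  [set a | positive_cone a /\ invertible a].

(* The positive square root of a; the default value 0 is only used when a has
   no positive square root, that is, when a is not positive. *)
Definition positive_sqrt a : A :=
  xget 0 [set s | positive_cone s /\ s * s = a].

End CStarAlgebra.

Arguments positive_cone {R} A.
Arguments positive_definite_cone {R} A.

Record jordan_star_isomorphism (R : realType) (A B : unitalCStarAlgType R)
    (J : A -> B) : Prop := JordanStarIsomorphism {
  jordan_linear : linear J;
  jordan_bijective : bijective J;
  jordan_sqr : forall a : A, J (a ^+ 2) = J a ^+ 2;
  jordan_star : forall a : A, J (star a) = star (J a)
}.

(* Main.v *)
Require Import Defs.
From HB Require Import structures.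
From mathcomp Require Import all_boot all_order all_algebra.
From mathcomp Require Import complex ring lra.
From mathcomp Require Import boolp classical_sets functions reals.
From mathcomp Require Import topology normedtype sequences.

Set Implicit Arguments.
Unset Strict Implicit.
Unset Printing Implicit Defensive.

Import Order.TTheory GRing.Theory Num.Theory.
Import numFieldNormedType.Exports.

Local Open Scope classical_set_scope.
Local Open Scope ring_scope.
Local Open Scope complex_scope.

(* Since a <= b if and only if |a + c| <= |b + c| for all positive definite c, the
   hypothesis makes T order preserving, and phi a = |T a|
   positively homogeneous, monotone and subadditive.  The relation T a <= T b means
   phi (a + c) <= phi (b + c) for all c, so it is invariant under scaling and
   translation.  If T k = 1 this gives T (c + t k) = T c + t, hence cancellation of
   translations, so that |T a - T b| depends on a - b only.  Then T extends by
   x |-> T (x + t k) - t to the self-adjoint elements, and by the Mazur-Ulam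
   argument the extension F is real linear.  With s = (T 1)^(1/2), the map
   s^-1 F s^-1 is a unital order isomorphism; the inequality f(a)^2 <= f(a^2) for it
   and for its inverse shows that it preserves squares.

   Positivity is handled without functional calculus: everything rests on square
   roots of 1 - x for |x| < 1, obtained as fixed points of a contraction, and on
   the fact that a self-adjoint a of norm 1 has 1 or -1 in its spectrum. *)

(** * Identities in noncommutative algebras *)

(** The hypothesis controls nothing but the norms of sums T a + T b. Surjectivity turns every
    positive definite test element of B into some T c, and this is how these norms come to determine
    the order. The element k with T k = 1 takes over the part of the unit of A, since T 1 need not
    be 1. The extension F is not known to preserve norms. What is known is that |F x - F y| is
    invariant under translations of A. This suffices for Mazur-Ulam, because reflections of A become
    isometries once conjugated into B. The inequality f(a)^2 <= f(a^2) would usually come from a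
    spectral measure of a. The Bernstein polynomials of a form a finite positive partition of unity
    whose moments replace it, with an error of order 1/n. The zero algebra is split off because the
    estimates use |1| = 1 in B. *)

Section Normalization.
Variables (R : realType) (A : unitalCStarAlgType R).
Implicit Types a b c x y : A.

Lemma scaleAl (l : R[i]) a b : l *: (a * b) = (l *: a) * b.
Proof. exact: cstar_scaleAl. Qed.

Lemma scaleAr (l : R[i]) a b : l *: (a * b) = a * (l *: b).
Proof. exact: cstar_scaleAr. Qed.

(* [alg] proves an identity between noncommutative polynomials by reducing it to
   the equality of the scalar coefficients of each word. *)
Inductive aexp :=
  | AVar of nat | AZero | AOne | AOpp of aexp | AAdd of aexp & aexp
  | AMul of aexp & aexp | AScale of R[i] & aexp.

Fixpoint aeval (env : seq A) (e : aexp) : A :=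
  match e with
  | AVar n => nth 0 env n
  | AZero => 0
  | AOne => 1
  | AOpp e1 => - aeval env e1
  | AAdd e1 e2 => aeval env e1 + aeval env e2
  | AMul e1 e2 => aeval env e1 * aeval env e2
  | AScale l e1 => l *: aeval env e1
  end.

(* A noncommutative polynomial is a list of monomials: a scalar and a word. *)
Definition apoly := seq (R[i] * seq nat).

(** These list operations duplicate the usual ones so that [cbv] can be given exactly their names
    and leaves the scalars untouched. *)
Fixpoint papp (p q : apoly) : apoly :=
  if p is m :: p' then m :: papp p' q else q.

Fixpoint wapp (v w : seq nat) : seq nat :=
  if v is n :: v' then n :: wapp v' w else w.

Fixpoint pscale (l : R[i]) (v : seq nat) (p : apoly) : apoly :=
  if p is (k, w) :: p' then (l * k, wapp v w) :: pscale l v p' else [::].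

Fixpoint pmul (p q : apoly) : apoly :=
  if p is (l, v) :: p' then papp (pscale l v q) (pmul p' q) else [::].

Fixpoint pnorm (e : aexp) : apoly :=
  match e with
  | AVar n => [:: (1, [:: n])]
  | AZero => [::]
  | AOne => [:: (1, [::])]
  | AOpp e1 => pscale (-1) [::] (pnorm e1)
  | AAdd e1 e2 => papp (pnorm e1) (pnorm e2)
  | AMul e1 e2 => pmul (pnorm e1) (pnorm e2)
  | AScale l e1 => pscale l [::] (pnorm e1)
  end.

Fixpoint neq (m n : nat) : bool :=
  match m, n with O, O => true | S m', S n' => neq m' n' | _, _ => false end.

Fixpoint weq (v w : seq nat) : bool :=
  match v, w with
  | [::], [::] => true
  | m :: v', n :: w' => if neq m n then weq v' w' else false
  | _, _ => false
  end.

Fixpoint pcoef (w : seq nat) (p : apoly) : R[i] :=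
  if p is (k, v) :: p' then
    if weq w v then k + pcoef w p' else pcoef w p' else 0.

Fixpoint prem (w : seq nat) (p : apoly) : apoly :=
  if p is (k, v) :: p' then
    if weq w v then prem w p' else (k, v) :: prem w p' else [::].

(** The number [n] is fuel, taken as the number of monomials. On a concrete polynomial this unfolds
    to a conjunction of scalar equations, one for each distinct word. *)
Fixpoint pzero (n : nat) (p : apoly) : Prop :=
  if p is (k, w) :: p' then
    if n is n'.+1 then k + pcoef w p' = 0 /\ pzero n' (prem w p') else False
  else True.

Fixpoint plen (p : apoly) : nat := if p is _ :: p' then (plen p').+1 else O.

Definition weval (env : seq A) (w : seq nat) : A :=
  foldr (fun n a => nth 0 env n * a) 1 w.

Definition peval (env : seq A) (p : apoly) : A :=
  foldr (fun m a => m.1 *: weval env m.2 + a) 0 p.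

Lemma peval_app env p q : peval env (papp p q) = peval env p + peval env q.
Proof. by elim: p => [|m p IH] /=; rewrite ?add0r // IH addrA. Qed.

Lemma weval_app env v w : weval env (wapp v w) = weval env v * weval env w.
Proof. by elim: v => [|n v IH] /=; rewrite ?mul1r // IH mulrA. Qed.

Lemma peval_scale env l v p :
  peval env (pscale l v p) = l *: (weval env v * peval env p).
Proof.
elim: p => [|[k w] p IH] /=; first by rewrite mulr0 scaler0.
by rewrite IH weval_app mulrDr scalerDr -scaleAr scalerA.
Qed.

Lemma peval_mul env p q : peval env (pmul p q) = peval env p * peval env q.
Proof.
elim: p => [|[l v] p IH] /=; first by rewrite mul0r.
by rewrite peval_app peval_scale IH mulrDl -scaleAl.
Qed.

Lemma pnormE env e : peval env (pnorm e) = aeval env e.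
Proof.
elim: e => [n|||e IH|e IH e' IH'|e IH e' IH'|l e IH] //=.
- by rewrite scale1r mulr1 addr0.
- by rewrite scale1r addr0.
- by rewrite peval_scale IH mul1r scaleN1r.
- by rewrite peval_app IH IH'.
- by rewrite peval_mul IH IH'.
- by rewrite peval_scale IH mul1r.
Qed.

Lemma weqP v w : weq v w -> v = w.
Proof.
have neqP m n : neq m n -> m = n.
  by elim: m n => [|m IH] [|n] //= /IH ->.
elim: v w => [|m v IH] [|n w] //=; case E: (neq m n) => // /IH ->.
by rewrite (neqP _ _ E).
Qed.

Lemma pcoefE env w p :
  peval env p = pcoef w p *: weval env w + peval env (prem w p).
Proof.
elim: p => [|[k v] p IH] /=; first by rewrite scale0r addr0.
case E: (weq w v); last by rewrite /= IH addrCA.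
by rewrite (weqP E) in IH *; rewrite scalerDl -addrA -IH.
Qed.

Lemma pzeroP env n p : pzero n p -> peval env p = 0.
Proof.
elim: n p => [|n IH] [|[k w] p] //= [h /IH h'].
by rewrite (pcoefE env w p) h' addr0 -scalerDl h scale0r.
Qed.

Lemma aexp_eq env e1 e2 :
  (let p := pnorm (AAdd e1 (AOpp e2)) in pzero (plen p) p) ->
  aeval env e1 = aeval env e2.
Proof. by move=> /(pzeroP env); rewrite pnormE /= => /subr0_eq. Qed.

End Normalization.

Ltac in_env x env :=
  lazymatch env with
  | cons x _ => constr:(true)
  | cons _ ?env' => in_env x env'
  | _ => constr:(false)
  end.

Ltac index_env x env :=
  lazymatch env with
  | cons x _ => constr:(O)
  | cons _ ?env' => let n := index_env x env' in constr:(S n)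
  end.

Ltac atoms t env :=
  lazymatch t with
  | @GRing.add _ ?a ?b => let env := atoms a env in atoms b env
  | @GRing.opp _ ?a => atoms a env
  | @GRing.mul _ ?a ?b => let env := atoms a env in atoms b env
  | @GRing.scale _ _ _ ?a => atoms a env
  | @GRing.zero _ => env
  | @GRing.one _ => env
  | _ => lazymatch in_env t env with
         | true => env
         | false => constr:(cons t env)
         end
  end.

Ltac reify R t env :=
  lazymatch t with
  | @GRing.add _ ?a ?b =>
      let a := reify R a env in let b := reify R b env in
      constr:(@AAdd R a b)
  | @GRing.opp _ ?a => let a := reify R a env in constr:(@AOpp R a)
  | @GRing.mul _ ?a ?b =>
      let a := reify R a env in let b := reify R b env in
      constr:(@AMul R a b)
  | @GRing.scale _ _ ?l ?a =>
      let a := reify R a env in constr:(@AScale R l a)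
  | @GRing.zero _ => constr:(@AZero R)
  | @GRing.one _ => constr:(@AOne R)
  | _ => let n := index_env t env in constr:(@AVar R n)
  end.

Ltac alg_scalars :=
  cbv beta;
  lazymatch goal with
  | |- @eq ?T ?t ?u =>
    match goal with
    | A : unitalCStarAlgType ?R |- _ =>
      unify T (UnitalCStarAlgebra.sort A);
      let env := atoms t (@nil (UnitalCStarAlgebra.sort A)) in
      let env := atoms u env in
      let e1 := reify R t env in
      let e2 := reify R u env in
      change (@aeval R A env e1 = @aeval R A env e2);
      apply: aexp_eq;
      cbv [papp wapp pscale pmul pnorm neq weq pcoef prem pzero plen]
    end
  end.

Ltac alg := alg_scalars; do ?split; ring.
Ltac algf := alg_scalars; do ?split; field.

(* [lra] fails on hypotheses that are equations in an unordered ring. *)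
Ltac clear_alg :=
  repeat match goal with
  | A : unitalCStarAlgType _, H : @eq ?T _ _ |- _ =>
      unify T (UnitalCStarAlgebra.sort A); clear H
  | A : unitalCStarAlgType _, H : @eq ?T _ _ /\ _ |- _ =>
      unify T (UnitalCStarAlgebra.sort A); clear H
  end.

Ltac rlra := clear_alg; lra.
Ltac rnra := clear_alg; nra.

(** * The norm and the involution *)

Section Norm.
Variables (R : realType) (A : unitalCStarAlgType R).
Implicit Types (a b c x y : A) (r t : R).

Local Notation e := (1 : A).

(** The order of [R[i]] is partial; a norm with values in [R] is accessible to [lra] and [nra]. *)
Definition nrm a : R := complex.Re `|a|.

Lemma nrmE a : `|a| = (nrm a)%:C.
Proof. by rewrite /nrm; have /ger0_Im := normr_ge0 a; case: `|a| => u v /= ->. Qed.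

Lemma nrm_ge0 a : 0 <= nrm a.
Proof. by have := normr_ge0 a; rewrite nrmE ler0c. Qed.

Lemma nrm0 : nrm 0 = 0.
Proof. by rewrite /nrm normr0. Qed.

Lemma nrm_eq0 a : nrm a = 0 -> a = 0.
Proof. by move=> h; apply/eqP; rewrite -normr_eq0 nrmE h. Qed.

Lemma nrmN a : nrm (- a) = nrm a.
Proof. by rewrite /nrm normrN. Qed.

Lemma nrmBC a b : nrm (a - b) = nrm (b - a).
Proof. by rewrite -nrmN opprB. Qed.

Lemma nrmD a b : nrm (a + b) <= nrm a + nrm b.
Proof. by have := ler_normD a b; rewrite !nrmE -rmorphD lecR. Qed.

Lemma nrm_triangle c a b : nrm (a - b) <= nrm (a - c) + nrm (c - b).
Proof. by apply: le_trans (nrmD _ _); rewrite addrA subrK. Qed.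

Lemma nrmM a b : nrm (a * b) <= nrm a * nrm b.
Proof. by have := cstar_normM a b; rewrite !nrmE -rmorphM lecR. Qed.

Lemma nrmZc (l : R[i]) a : (nrm (l *: a))%:C = `|l| * (nrm a)%:C.
Proof. by rewrite -!nrmE normrZ. Qed.

Lemma nrmZ r a : nrm (r%:C *: a) = `|r| * nrm a.
Proof.
apply: complexI; rewrite nrmZc rmorphM /=; congr (_ * _).
by rewrite normc_def /= expr0n addr0 sqrtr_sqr.
Qed.

Lemma nrmS a : nrm (star a * a) = nrm a ^+ 2.
Proof. by apply: complexI; rewrite rmorphXn /= -!nrmE; exact: cstar_identity. Qed.

Lemma nrm_star a : nrm (star a) = nrm a.
Proof.
suff h b : nrm b <= nrm (star b).
  by apply/eqP; rewrite eq_le h -{2}[a]starK h.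
have [/eqP|b0] := boolP (nrm b == 0); first by move=> ->; exact: nrm_ge0.
have bp : 0 < nrm b by rewrite lt_def b0 nrm_ge0.
by rewrite -(ler_pM2r bp) -expr2 -nrmS nrmM.
Qed.

Lemma starB a b : star (a - b) = star a - star b.
Proof.
have starN c : star (- c) = - star c.
  by rewrite -scaleN1r starZ rmorphN1 scaleN1r.
by rewrite starD starN.
Qed.

Lemma starZr r a : star (r%:C *: a) = r%:C *: star a.
Proof. by rewrite starZ; congr (_ *: _); exact: conjc_real. Qed.

Lemma starZi a : star ('i%C *: a) = - ('i%C *: star a).
Proof.
rewrite starZ -scaleNr; congr (_ *: _).
by apply/eqP; rewrite eq_complex /= oppr0 !eqxx.
Qed.

Lemma star_mul a b : star (a * b) = star b * star a.
Proof. exact: starM. Qed.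

Lemma star1 : star e = e.
Proof. by rewrite -[LHS]mul1r -{1}[e]starK -star_mul mul1r starK. Qed.

Lemma nrm_sa a : a = star a -> nrm (a * a) = nrm a ^+ 2.
Proof. by move=> sa; rewrite {1}sa nrmS. Qed.

Lemma nrm1_le : nrm e <= 1.
Proof.
have := nrm_sa (esym star1); rewrite mulr1 expr2.
have := nrm_ge0 e; nra.
Qed.

Lemma nrm_scalar r : 0 <= r -> nrm (r%:C *: e) <= r.
Proof. by move=> h; rewrite nrmZ ger0_norm // ler_piMr // nrm1_le. Qed.

Lemma nrm_small_eq0 a : (forall r, 0 < r -> nrm a <= r) -> a = 0.
Proof.
move=> h; apply: nrm_eq0; apply/eqP; rewrite eq_le nrm_ge0 andbT.
by rewrite leNgt; apply/negP => p; have := h (nrm a / 2); lra.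
Qed.

(** Closedness by approximants: it carries the invariants of an iteration, such as self-adjointness
    and commutation, over to its limit. *)
Definition limit_closed (S : A -> Prop) :=
  forall y, (forall r, 0 < r -> exists2 z, S z & nrm (y - z) <= r) -> S y.

Lemma expr_small (q r : R) : 0 <= q < 1 -> 0 < r -> exists n, q ^+ n < r.
Proof.
move=> /andP[q0 q1] r0.
have /cvgr0Pnorm_lt/(_ r r0) : GRing.exp q @ \oo --> 0.
  by apply: cvg_expr; rewrite ger0_norm.
case=> N _ /(_ N (leqnn N)) h; exists N; apply: le_lt_trans h.
exact: ler_norm.
Qed.

Lemma contraction_fixpoint (S : A -> Prop) (F : A -> A) (q : R) (x0 : A) :
  0 <= q < 1 -> limit_closed S -> S x0 ->
  (forall x, S x -> S (F x)) ->
  (forall x y, S x -> S y -> nrm (F x - F y) <= q * nrm (x - y)) ->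
  exists2 y, S y & F y = y.
Proof.
move=> q01 Scl S0 SF Fq; have /andP[q0 q1] := q01.
pose u n := iter n F x0.
have Su n : S (u n) by elim: n => //= n IH; apply: SF.
(* The sum of the geometric series of step lengths, the solution of K = q K + |F x0 - x0|. *)
pose K := nrm (F x0 - x0) / (1 - q).
have K0 : 0 <= K by rewrite divr_ge0 ?nrm_ge0 //; lra.
have uK m : nrm (u m - x0) <= K.
  elim: m => [|m IH]; first by rewrite subrr nrm0.
  apply: (le_trans (nrm_triangle (F x0) _ _)).
  have := Fq (u m) x0 (Su m) S0.
  have : K = q * K + nrm (F x0 - x0) by rewrite /K; field; lra.
  by rewrite -/(u m.+1) => ->; nra.
have unK n m : nrm (u (n + m)%N - u n) <= q ^+ n * K.
  elim: n => [|n IH]; first by rewrite expr0 mul1r add0n uK.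
  rewrite exprS -mulrA; apply: le_trans (ler_wpM2l q0 IH).
  exact: Fq.
have small r : 0 < r -> exists N, forall n, (N <= n)%N -> nrm (u n - u N) < r.
  move=> r0.
  have r1 : 0 < r / (K + 1) by rewrite divr_gt0 //; lra.
  have [N hN] := expr_small q01 r1.
  exists N => n Nn; rewrite -(subnKC Nn); apply: le_lt_trans (unK _ _) _.
  have h : q ^+ N * (K + 1) < r by rewrite -ltr_pdivlMr //; lra.
  by apply: le_lt_trans h; apply: ler_wpM2l; [exact: exprn_ge0 | lra].
have ucvg : cvg (u @ \oo).
  apply: cauchy_cvg; apply: cauchy_exP => eps; rewrite ltcE => /andP[/eqP i0 e0].
  have [N hN] := small _ e0.
  exists (u N); exists N => // n Nn; rewrite -ball_normE /ball_ /= nrmE.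
  rewrite ltcE /= i0 eqxx nrmBC; exact: hN.
have [y uy] : exists y, forall r, 0 < r -> exists N, forall n, (N <= n)%N ->
    nrm (y - u n) < r.
  exists (lim (u @ \oo)) => r r0.
  have /cvgrPdist_lt /(_ r%:C) : u @ \oo --> lim (u @ \oo) by [].
  rewrite ltcR => /(_ r0) [N _ hN]; exists N => n /hN /=.
  by rewrite nrmE ltcR.
have Sy : S y.
  apply: Scl => r /uy [N hN]; exists (u N) => //; exact/ltW/hN.
exists y => //; apply/eqP; rewrite -subr_eq0; apply/eqP/nrm_small_eq0 => r r0.
have /uy [N hN] : 0 < r / 2 by lra.
apply: le_trans (nrm_triangle (u N.+1) _ _) _.
have := Fq y (u N) Sy (Su N); have := hN N (leqnn N).
have := hN N.+1 (leqnSn N); rewrite nrmBC -/(u N.+1).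
have := nrm_ge0 (y - u N); nra.
Qed.

End Norm.

(** * Invertible elements *)

Section Invertible.
Variables (R : realType) (A : unitalCStarAlgType R).
Implicit Types (a b c x y : A) (r t : R).

Local Notation e := (1 : A).

Lemma invertible_of a b c : a * b = e -> c * a = e -> invertible a.
Proof.
move=> ab ca; exists b; split=> //.
by rewrite -[b]mul1r -{1}ca -(mulrA c) ab mulr1.
Qed.

Lemma invertibleM a b : invertible a -> invertible b -> invertible (a * b).
Proof.
move=> [a' [aa' a'a]] [b' [bb' b'b]]; exists (b' * a'); split.
  by rewrite mulrA -(mulrA a) bb' mulr1.
by rewrite mulrA -(mulrA b') a'a mulr1.
Qed.

Lemma invertibleZ (l : R[i]) a : l != 0 -> invertible a -> invertible (l *: a).
Proof.
move=> l0 [b [ab ba]]; exists (l^-1 *: b).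
by rewrite -!scaleAl -!scaleAr !scalerA ab ba divff // mulVf // scale1r.
Qed.

Lemma invertible_factor a b : a * b = b * a -> invertible (a * b) -> invertible a.
Proof.
move=> ab [c [abc cab]]; apply: (@invertible_of _ (b * c) (c * b)).
  by rewrite mulrA.
by rewrite -mulrA -ab.
Qed.

(** A right and a left inverse arise separately as fixed points of y |-> 1 + x y and y |-> 1 + y x;
    they then coincide. *)
Lemma invertible_neumann x : nrm x < 1 -> invertible (e - x).
Proof.
move=> x1; have q01 : 0 <= nrm x < 1 by rewrite nrm_ge0.
have cl : @limit_closed R A (fun=> True) by [].
have [y _ hy] := @contraction_fixpoint _ _ _ (fun y => e + x * y) _ 0 q01 cl I
  (fun _ _ => I)
  ltac:(by move=> u v _ _ /=; rewrite opprD addrACA subrr add0r -mulrBr nrmM).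
have [z _ hz] := @contraction_fixpoint _ _ _ (fun y => e + y * x) _ 0 q01 cl I
  (fun _ _ => I)
  ltac:(by move=> u v _ _ /=; rewrite opprD addrACA subrr add0r -mulrBl
                                  (mulrC (nrm x)) nrmM).
apply: (@invertible_of _ y z).
  by rewrite mulrBl mul1r -{1}hy addrK.
by rewrite mulrBr mulr1 -{1}hz addrK.
Qed.

Lemma invertible_far x (l : R[i]) : `|x| < `|l| -> invertible (x - l *: e).
Proof.
move=> xl; have l0 : l != 0.
  by apply: contraTneq xl => ->; rewrite normr0 nrmE ltcR -leNgt nrm_ge0.
have -> : x - l *: e = - l *: (e - l^-1 *: x).
  by rewrite scalerBr scalerA mulNr divff // scaleN1r scaleNr opprK addrC.
apply: invertibleZ; first by rewrite oppr_eq0.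
apply: invertible_neumann; rewrite -ltcR -nrmE normrZ normfV mulrC.
by rewrite ltr_pdivrMr ?normr_gt0 // mul1r.
Qed.

Lemma invertible_far_real x r : nrm x < `|r| -> invertible (x + r%:C *: e).
Proof.
move=> h; have -> : x + r%:C *: e = x - (- r)%:C *: e by alg.
apply: invertible_far; rewrite nrmE normc_def /= expr0n addr0 sqrtr_sqr ltcR.
by rewrite normrN.
Qed.

Lemma invertible_perturb a b x : a * b = e -> b * a = e -> nrm x * nrm b < 1 ->
  invertible (a - x).
Proof.
move=> ab ba h; have -> : a - x = a * (e - b * x).
  by rewrite mulrBr mulr1 mulrA ab mul1r.
apply: invertibleM; first by exists b.
by apply: invertible_neumann; apply: le_lt_trans (nrmM _ _) _; rewrite mulrC.
Qed.

Lemma limit_closed_bound r : @limit_closed R A (fun y => nrm y <= r).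
Proof.
move=> y h; apply/ler_addgt0Pr => t /h [z zr yz].
have := nrmD (y - z) z; rewrite subrK; lra.
Qed.

Lemma limit_closed_sa : @limit_closed R A (fun y => y = star y).
Proof.
move=> y h; apply: subr0_eq; apply: nrm_small_eq0 => r r0.
have [|z zz yz] := h (r / 2); first by lra.
have := nrm_triangle z y (star y); rewrite {2}zz -starB nrm_star (nrmBC z y); lra.
Qed.

Lemma limit_closed_comm c : @limit_closed R A (fun y => y * c = c * y).
Proof.
move=> y h; apply: subr0_eq; apply: nrm_small_eq0 => r r0.
have c0 := nrm_ge0 c.
have [|z zc yz] := h (r / (2 * (nrm c + 1))); first by rewrite divr_gt0 //; lra.
have -> : y * c - c * y = (y - z) * c - c * (y - z).
  have -> : (y - z) * c - c * (y - z) = y * c - c * y - (z * c - c * z) by alg.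
  by rewrite zc subrr subr0.
apply: le_trans (nrmD _ _) _; rewrite nrmN.
have := nrmM (y - z) c; have := nrmM c (y - z).
have : nrm (y - z) * (2 * (nrm c + 1)) <= r.
  by rewrite -ler_pdivlMr //; lra.
have := nrm_ge0 (y - z); lra.
Qed.

(* The root is [1 - y] with [y] the fixed point of [y |-> (x + y * y) / 2]. *)
Lemma sqrt_exists x : x = star x -> nrm x < 1 ->
  exists y, [/\ y = star y, nrm y < 1, (e - y) * (e - y) = e - x
              & forall c, x * c = c * x -> y * c = c * y].
Proof.
move=> sx x1; pose q := nrm x; have q01 : 0 <= q < 1 by rewrite nrm_ge0.
have /andP[q0 q1] := q01.
(* The last condition makes any two elements of [S] commute, so y^2 - z^2 factors as (y + z)(y - z)
   and [F] contracts by (|y| + |z|) / 2 <= q. *)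
pose S y := [/\ nrm y <= q, y = star y & forall c, x * c = c * x -> y * c = c * y].
pose F y := (1/2)%:C *: (x + y * y).
have half : `|1/2 : R| = 1/2 by rewrite ger0_norm //; lra.
have Scl : limit_closed S.
  move=> y h; split.
  - by apply: limit_closed_bound => r /h [z [? _ _] ?]; exists z.
  - by apply: limit_closed_sa => r /h [z [_ ? _] ?]; exists z.
  - move=> c xc; apply: limit_closed_comm => r /h [z [_ _ zc] ?].
    by exists z => //; apply: zc.
have S0 : S 0.
  split; [by rewrite nrm0 | | by move=> c _; rewrite mul0r mulr0].
  by rewrite -[in RHS](subrr e) starB subrr.
have SF y : S y -> S (F y).
  move=> [yq sy yc]; split.
  - rewrite nrmZ half; have := nrmD x (y * y); have := nrmM y y.
    have := nrm_ge0 y; rewrite -/q; nra.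
  - by rewrite starZr starD star_mul -sx -sy.
  - move=> c xc; rewrite /F -scaleAl -scaleAr mulrDl mulrDr xc; congr (_ *: (_ + _)).
    by rewrite -mulrA (yc c xc) mulrA (yc c xc) mulrA.
have Fq y z : S y -> S z -> nrm (F y - F z) <= q * nrm (y - z).
  move=> [yq sy yc] [zq sz zc].
  have yz : y * z = z * y by apply: yc; rewrite zc.
  have -> : F y - F z = (1/2)%:C *: ((y + z) * (y - z)).
    have -> : (y + z) * (y - z) = y * y - z * z - (y * z - z * y) by alg.
    by rewrite yz subrr subr0 /F; alg.
  rewrite nrmZ half; have := nrmM (y + z) (y - z); have := nrmD y z.
  have := nrm_ge0 (y - z); nra.
have [y [yq sy yc] yF] := contraction_fixpoint q01 Scl S0 SF Fq.
exists y; split=> //; first exact: le_lt_trans yq q1.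
have -> : (e - y) * (e - y) = e - (2%:C *: y - y * y) by alg.
congr (_ - _); rewrite -{1}yF /F scalerA -rmorphM /=.
have -> : 2 * (1 / 2) = 1 :> R by lra.
by rewrite scale1r addrK.
Qed.

Lemma sa_shift_im x r : x = star x ->
  let z := x + r%:C *: ('i%C *: e) in
  star z = x - r%:C *: ('i%C *: e) /\ star z * z = x * x + (r ^+ 2)%:C *: e.
Proof.
move=> sx z; have zE : star z = x - r%:C *: ('i%C *: e).
  by rewrite /z starD starZr starZi star1 -sx; alg.
split=> //; rewrite zE /z; have := sqr_i R; move: 'i%C => j hj.
by alg_scalars; do ?split; ring: hj.
Qed.

(** Shift by i t: |x + i t|^2 <= |x|^2 + t^2, while (r + t)^2 has the extra terms 2 r t and r^2. The
    choice 2 r t = |x|^2 leaves the gap r^2. *)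
Lemma invertible_sa_sub_im x r : x = star x -> r != 0 ->
  invertible (x - (r%:C * 'i%C) *: e).
Proof.
move=> sx r0; pose t := nrm x ^+ 2 / (2 * r).
have rt : r * t = nrm x ^+ 2 / 2 by rewrite /t; field.
have r2 : 0 < r ^+ 2 by rewrite lt_def sqrf_eq0 r0 sqr_ge0.
pose z := x + t%:C *: ('i%C *: e).
have -> : x - (r%:C * 'i%C) *: e = z - ((r + t)%:C * 'i%C) *: e by rewrite /z; alg.
apply: invertible_far; rewrite nrmE normrM.
have -> : `|'i%C : R[i]| = 1.
  by rewrite normc_def /= expr0n add0r expr1n sqrtr1.
rewrite mulr1 normc_def /= expr0n addr0 sqrtr_sqr ltcR.
suff: nrm z ^+ 2 < (r + t) ^+ 2.
  rewrite -(real_normK (num_real (r + t))) => h; rewrite ltNge.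
  by apply/negP; have := normr_ge0 (r + t); nra.
rewrite -nrmS.
have [_ ->] := sa_shift_im t sx.
apply: le_lt_trans (nrmD _ _) _.
have := nrm_scalar A (sqr_ge0 t); rewrite nrm_sa //; nra.
Qed.

Lemma spectrum_sa_real x (l : R[i]) : x = star x -> spectrum x l ->
  l = (complex.Re l)%:C.
Proof.
move=> sx; case: l => u v; have [->//|v0] := eqVneq v 0.
case; have -> : x - (u +i* v) *: e = (x - u%:C *: e) - (v%:C * 'i%C) *: e.
  have -> : u +i* v = u%:C + v%:C * 'i%C.
    by apply/eqP; rewrite eq_complex /=; apply/andP; split; apply/eqP; ring.
  by alg.
by apply: invertible_sa_sub_im => //; rewrite starB starZr star1 -sx.
Qed.

End Invertible.

(** * Positive elements *)

Section Positive.
Variables (R : realType) (A : unitalCStarAlgType R).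
Implicit Types (a b c q x y : A) (r t : R).

Local Notation e := (1 : A).
Local Notation pos := (positive_cone A).
Local Notation pdef := (positive_definite_cone A).

(** A case of monotonicity of the norm obtained before any order is available: z = x + i y satisfies
    z^* z = x^2 + y^2, and its real part x has |x| <= |z|. *)
Lemma nrm_sqr_le x y : x = star x -> y = star y -> x * y = y * x ->
  nrm (x * x) <= nrm (x * x + y * y).
Proof.
move=> sx sy xy; pose z := x + 'i%C *: y.
have sz : star z = x - 'i%C *: y by rewrite /z starD starZi -sx -sy.
have zz : star z * z = x * x + y * y.
  transitivity (x * x + y * y + 'i%C *: (x * y - y * x)); last first.
    by rewrite xy subrr scaler0 addr0.
  rewrite sz /z; have := sqr_i R; move: 'i%C => j hj.
  by alg_scalars; do ?split; ring: hj.
rewrite -zz nrmS nrm_sa //.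
have -> : x = (1/2)%:C *: (z + star z) by rewrite sz /z; algf.
have := nrmD z (star z); rewrite nrmZ nrm_star ger0_norm; last by rlra.
by have := nrm_ge0 (z + star z); have := nrm_ge0 z; rnra.
Qed.

Lemma sa1 : e = star e.
Proof. by rewrite star1. Qed.

Lemma saD a b : a = star a -> b = star b -> a + b = star (a + b).
Proof. by rewrite starD => <- <-. Qed.

Lemma saB a b : a = star a -> b = star b -> a - b = star (a - b).
Proof. by rewrite starB => <- <-. Qed.

Lemma saZ r a : a = star a -> r%:C *: a = star (r%:C *: a).
Proof. by rewrite starZr => <-. Qed.

Lemma saM a b : a = star a -> b = star b -> a * b = b * a ->
  a * b = star (a * b).
Proof. by rewrite star_mul => <- <-. Qed.

Lemma saMM a b : a = star a -> b = star b -> a * b * a = star (a * b * a).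
Proof. by rewrite !star_mul mulrA => <- <-. Qed.

Lemma comm_inv a b c : a * b = e -> b * a = e -> a * c = c * a -> b * c = c * b.
Proof.
move=> ab ba ac; rewrite -[c in LHS]mulr1 -ab (mulrA c) -ac mulrA.
by rewrite mulrA ba mul1r.
Qed.

Lemma sa_inv a b : a = star a -> a * b = e -> b * a = e -> b = star b.
Proof.
move=> sa ab ba; have h : star b * a = e by rewrite {1}sa -star_mul ab star1.
by rewrite -[star b]mulr1 -ab mulrA h mul1r.
Qed.

(* Were [1 - a^2] invertible, the roots [y] of [1 - r^2 a^2] would have inverses
   bounded as [r] tends to [1], so that [y^2 - delta] would still be a square
   [v^2] commuting with [a]; then [r^2 a^2 <= r^2 a^2 + v^2 = 1 - delta]. *)
Lemma sa_norm1_spectrum a : a = star a -> nrm a = 1 -> ~ invertible (e - a * a).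
Proof.
move=> sa a1 [b ib].
pose M : R := 2 * nrm b + 1; have M1 : 1 <= M by have := nrm_ge0 b; rewrite /M; rlra.
(* Then 1 - r^2 <= 1 / (4 M). This is small enough for the bound |w^2| <= M on the inverse of 1 -
   r^2 a^2, and smaller than [d] = 1 / (2 M), which gives the final contradiction r^2 <= 1 - d. *)
pose r : R := 1 - 1 / (8 * M).
have rM : (1 - r) * (8 * M) = 1 by rewrite /r; field; rlra.
have r01 : 0 < r < 1 by apply/andP; split; rnra.
have /andP[r0 r1] := r01.
pose x := r%:C *: a.
have sx : x = star x by exact: saZ.
have nx : nrm (x * x) = r ^+ 2 by rewrite nrm_sa // nrmZ a1 mulr1 ger0_norm // ltW.
have x21 : nrm (x * x) < 1 by rewrite nx; rnra.
have [y hy] := sqrt_exists (saM sx sx erefl) x21.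
have [sy y1 _ yc] := hy.
pose y' := e - y; have sy' : y' = star y' by apply: saB => //; exact: sa1.
have y2 : (y' * y' = e - x * x) /\ True by have [_ _ ? _] := hy.
have [w yw] := invertible_neumann y1; rewrite -/y' in yw.
have sw : w = star w by apply: sa_inv yw.1 yw.2.
have ww : (e - x * x) * (w * w) = e /\ (w * w) * (e - x * x) = e.
  rewrite -y2.1; split; first by rewrite -mulrA (mulrA y' w) yw.1 mul1r yw.1.
  by rewrite -mulrA (mulrA w y') yw.2 mul1r yw.2.
have a2 : nrm (a * a) = 1 by rewrite nrm_sa // a1 expr1n.
have wM : nrm (w * w) <= M.
  have E : (w * w - b = ((1 - r ^+ 2)%:C) *: - ((w * w) * (a * a) * b)) /\ True.
    split=> //.
    have : (w * w) * ((e - a * a) - (e - x * x)) * b = w * w - b.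
      by rewrite mulrBr mulrBl ww.2 mul1r -mulrA ib.1 mulr1.
    by move=> <-; rewrite /x; alg.
  have h1 : nrm (w * w * (a * a) * b) <= nrm (w * w) * nrm b.
    apply: le_trans (nrmM _ _) _; apply: ler_wpM2r; first exact: nrm_ge0.
    by apply: le_trans (nrmM _ _) _; rewrite a2 mulr1.
  have := nrmD (w * w - b) b; rewrite subrK E.1 nrmZ nrmN ger0_norm; last rnra.
  have h2 : (1 - r ^+ 2) * nrm b <= 1/4.
    apply: (@le_trans _ _ (2 * (1 - r) * M)); last by rnra.
    have := nrm_ge0 b; rewrite /M in rM M1 *; rnra.
  have := nrm_ge0 (w * w); have := nrm_ge0 b; rewrite /M; rnra.
have Mi : (2 * M)^-1 * (2 * M) = 1 by rewrite mulVf //; rlra.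
pose d : R := (2 * M)^-1; have d0 : 0 < d by rewrite invr_gt0; rlra.
have d1 : d <= 1/2 by rewrite -/d in Mi; rnra.
have sww : d%:C *: (w * w) = star (d%:C *: (w * w)) by apply: saZ; apply: saM.
have dww : nrm (d%:C *: (w * w)) < 1.
  by rewrite nrmZ gtr0_norm //; have := nrm_ge0 (w * w); rewrite -/d in Mi; rnra.
have [v hv] := sqrt_exists sww dww.
have [sv _ _ vc] := hv; pose v' := e - v.
have sv' : v' = star v' by apply: saB => //; exact: sa1.
have cmul c : w * c = c * w -> v' * c = c * v'.
  move=> wc; rewrite /v' mulrBl mulrBr mul1r mulr1 vc //.
  by rewrite -scaleAl -scaleAr -mulrA wc mulrA wc -mulrA.
have ya : y' * a = a * y'.
  rewrite /y' mulrBl mulrBr mul1r mulr1 yc //.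
  by rewrite /x; alg.
have wa : w * a = a * w by apply: comm_inv yw.1 yw.2 ya.
have vy : v' * y' = y' * v' by apply: cmul; rewrite yw.1 yw.2.
have va : v' * a = a * v' by apply: cmul.
have key : x * x + (y' * v') * (y' * v') = (1 - d)%:C *: e.
  have -> : y' * v' * (y' * v') = y' * y' * (v' * v').
    by rewrite -!mulrA; congr (_ * _); rewrite !mulrA vy.
  have -> : v' * v' = e - d%:C *: (w * w) by have [_ _ ? _] := hv.
  by rewrite y2.1 mulrBr mulr1 -(scaleAr d%:C) ww.1; alg.
have xyv : x * (y' * v') = (y' * v') * x.
  by rewrite /x -scaleAl -scaleAr; congr (_ *: _); rewrite mulrA -ya -mulrA -va mulrA.
have := nrm_sqr_le sx (saM sy' sv' (esym vy)) xyv.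
rewrite key nx nrmZ ger0_norm; last by rlra.
have := nrm1_le A; have := nrm_ge0 e; rewrite -/d in Mi; rnra.
Qed.

(** Self-adjoint elements have real spectrum, so only shifts by real scalars have to be tested. *)
Lemma positiveE a : pos a <->
  a = star a /\ forall r, 0 < r -> invertible (a + r%:C *: e).
Proof.
split=> [[sa pa]|[sa h]]; split=> //.
- move=> r r0; apply: contrapT => h.
  have : spectrum a (- r%:C).
    by rewrite /spectrum /= scaleNr opprK.
  by move=> /pa /=; rewrite -rmorphN ler0c; rlra.
- move=> l /[dup] /(spectrum_sa_real sa) -> /= hl.
  rewrite ler0c leNgt; apply/negP => l0; apply: hl.
  have := h (- complex.Re l); rewrite oppr_gt0 => /(_ l0).
  by rewrite rmorphN scaleNr.
Qed.

Lemma pos_sa a : pos a -> a = star a.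
Proof. by case. Qed.

Lemma nrm_le_pos a r : a = star a -> nrm a <= r -> pos (r%:C *: e - a).
Proof.
move=> sa ar; apply/positiveE; split; first by apply: saB => //; apply/saZ/sa1.
move=> t t0; have -> : r%:C *: e - a + t%:C *: e = - a + (r + t)%:C *: e by alg.
apply: invertible_far_real; rewrite nrmN ger0_norm; have := nrm_ge0 a; rlra.
Qed.

(** If n = |a| > r, then n - a and n + a are invertible, hence so is 1 - (a / n)^2, against
    [sa_norm1_spectrum]. *)
Lemma posN_nrm a r : 0 <= r -> pos (r%:C *: e - a) -> pos (r%:C *: e + a) ->
  nrm a <= r.
Proof.
move=> r0 p1 p2; rewrite leNgt; apply/negP => h.
pose n : R := nrm a; have n0 : 0 < n by rewrite /n; rlra.
have sa : a = star a.
  have := pos_sa p2; rewrite starD -(saZ r sa1) => /addrI; exact.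
have i1 : invertible (n%:C *: e - a).
  have /positiveE [_ /(_ (n - r))] := p1; rewrite subr_gt0 => /(_ h).
  by have -> : r%:C *: e - a + (n - r)%:C *: e = n%:C *: e - a by alg.
have i2 : invertible (n%:C *: e + a).
  have /positiveE [_ /(_ (n - r))] := p2; rewrite subr_gt0 => /(_ h).
  by have -> : r%:C *: e + a + (n - r)%:C *: e = n%:C *: e + a by alg.
have ni : n^-1 * n = 1 by rewrite mulVf //; rlra.
have niC : (n^-1)%:C * n%:C = 1 :> R[i] by rewrite -rmorphM ni.
apply: (@sa_norm1_spectrum ((n^-1)%:C *: a)); first exact: saZ.
  by rewrite nrmZ ger0_norm // invr_ge0 ltW.
have -> : e - (n^-1)%:C *: a * ((n^-1)%:C *: a) =
    ((n^-1)%:C * (n^-1)%:C) *: ((n%:C *: e - a) * (n%:C *: e + a)).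
  move: niC; move: (n%:C) (n^-1%:C) => p q pq.
  by alg_scalars; do ?split; ring: pq.
apply: invertibleZ; last exact: invertibleM.
have : n^-1%:C != 0 :> R[i].
  by apply/eqP => h0; move: niC; rewrite h0 mul0r => /esym/eqP; rewrite oner_eq0.
by move=> nz; rewrite mulf_neq0.
Qed.

(** Together with [nrm_pos] this turns positivity into membership in a ball, so that sums are
    handled by the triangle inequality. *)
Lemma pos_nrm a r : pos a -> nrm a <= r -> nrm (r%:C *: e - a) <= r.
Proof.
move=> pa ar; have r0 := le_trans (nrm_ge0 a) ar; have sa := pos_sa pa.
apply: posN_nrm => //.
  by have -> : r%:C *: e - (r%:C *: e - a) = a by alg.
have -> : r%:C *: e + (r%:C *: e - a) = (r + r)%:C *: e - a by alg.
by apply: nrm_le_pos => //; rlra.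
Qed.

Lemma nrm_pos a r : a = star a -> nrm (r%:C *: e - a) <= r -> pos a.
Proof.
move=> sa h; have -> : a = r%:C *: e - (r%:C *: e - a) by alg.
by apply: nrm_le_pos => //; apply: saB => //; apply/saZ/sa1.
Qed.

Lemma posD a b : pos a -> pos b -> pos (a + b).
Proof.
move=> pa pb; apply: (@nrm_pos _ (nrm a + nrm b)).
  by apply: saD; exact: pos_sa.
have -> : (nrm a + nrm b)%:C *: e - (a + b) =
  ((nrm a)%:C *: e - a) + ((nrm b)%:C *: e - b) by alg.
apply: le_trans (nrmD _ _) _.
by have := pos_nrm pa (lexx _); have := pos_nrm pb (lexx _); rlra.
Qed.

Lemma pos_scalar r : 0 <= r -> pos (r%:C *: e).
Proof.
move=> r0; have -> : r%:C *: e = r%:C *: e - 0 by rewrite subr0.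
apply: nrm_le_pos; last by rewrite nrm0.
by rewrite -[in RHS](subrr e) starB subrr.
Qed.

Lemma pos1 : pos e.
Proof. by have -> : e = 1%:C *: e; [alg | apply: pos_scalar; rlra]. Qed.

Lemma posZ r a : 0 <= r -> pos a -> pos (r%:C *: a).
Proof.
rewrite le_eqVlt => /orP[/eqP <- _|r0 pa].
  by have := pos_scalar (lexx 0); rewrite !scale0r.
apply/positiveE; split; first exact/saZ/pos_sa.
move=> t t0; have ri : r * r^-1 = 1 by rewrite mulfV //; rlra.
have -> : r%:C *: a + t%:C *: e = r%:C *: (a + (r^-1 * t)%:C *: e).
  have riC : r%:C * (r^-1)%:C = 1 :> R[i] by rewrite -rmorphM ri.
  rewrite rmorphM /=; move: riC; move: (r%:C) (r^-1%:C) => p q pq.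
  by alg_scalars; do ?split; ring: pq.
apply: invertibleZ.
  by rewrite -(rmorph0 (real_complex R)) (inj_eq (@complexI R)); rlra.
by have /positiveE [_] := pa; apply; rewrite mulr_gt0 // invr_gt0.
Qed.

Lemma pos_antisym a : pos a -> pos (- a) -> a = 0.
Proof.
move=> pa na; apply: nrm_eq0; apply/eqP; rewrite eq_le nrm_ge0 andbT.
by apply: posN_nrm => //; rewrite scale0r ?add0r ?sub0r.
Qed.

Lemma pos_archimedean a : a = star a ->
  (forall r, 0 < r -> pos (a + r%:C *: e)) -> pos a.
Proof.
move=> sa h; apply/positiveE; split=> // r r0.
have /h/positiveE [_ /(_ (r / 2))] : 0 < r / 2 by rlra.
have -> : a + (r / 2)%:C *: e + (r / 2)%:C *: e = a + r%:C *: e.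
  have -> : r%:C = (r / 2 + r / 2)%:C by congr (_%:C); rlra.
  by alg.
by apply; rlra.
Qed.

Lemma nrm_mono a b : pos a -> pos (b - a) -> nrm a <= nrm b.
Proof.
move=> pa pba; have sb : b = star b.
  by rewrite -(subrK a b); apply: saD; exact: pos_sa.
apply: posN_nrm; first exact: nrm_ge0.
  have -> : (nrm b)%:C *: e - a = ((nrm b)%:C *: e - b) + (b - a) by alg.
  by apply: posD => //; apply: nrm_le_pos.
by apply: posD => //; exact/pos_scalar/nrm_ge0.
Qed.

Lemma pos_invertible a r : 0 < r -> pos (a - r%:C *: e) -> invertible a.
Proof.
by move=> r0 /positiveE [_ /(_ r r0)]; rewrite subrK.
Qed.

Lemma pdefE a : pdef a <-> exists2 r, 0 < r & pos (a - r%:C *: e).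
Proof.
split=> [[pa [b [ab ba]]]|[r r0 h]]; last first.
  split; last exact: pos_invertible h.
  have -> : a = (a - r%:C *: e) + r%:C *: e by alg.
  by apply: posD => //; exact/pos_scalar/ltW.
have b0 : 0 < nrm b + 1 by have := nrm_ge0 b; rlra.
(* Below 1 / |b|, so that every perturbation of [a] by a scalar of size at most [r] stays
   invertible. *)
pose r : R := (nrm b + 1)^-1; have r0 : 0 < r by rewrite invr_gt0.
have rb : r * (nrm b + 1) = 1 by rewrite mulVf //; rlra.
exists r => //; have sa := pos_sa pa; apply/positiveE; split.
  by apply: saB => //; exact/saZ/sa1.
move=> t t0; have [rt|tr] := ltP r t.
  have /positiveE [_ /(_ (t - r))] := pa.
  have -> : a - r%:C *: e + t%:C *: e = a + (t - r)%:C *: e by alg.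
  by apply; rlra.
have -> : a - r%:C *: e + t%:C *: e = a - (r - t)%:C *: e by alg.
apply: invertible_perturb ab ba _.
have := @nrm_scalar R A (r - t); have := nrm_ge0 b; rnra.
Qed.

Lemma pdef_pos a : pdef a -> pos a.
Proof. by case. Qed.

Lemma pdef_sa a : pdef a -> a = star a.
Proof. by move/pdef_pos/pos_sa. Qed.

Lemma pdefDpos a b : pdef a -> pos b -> pdef (a + b).
Proof.
move=> /pdefE [r r0 ha] pb; apply/pdefE; exists r => //.
by rewrite addrAC; apply: posD.
Qed.

Lemma pdefD a b : pdef a -> pdef b -> pdef (a + b).
Proof. by move=> pa /pdef_pos; apply: pdefDpos. Qed.

Lemma pdefZ r a : 0 < r -> pdef a -> pdef (r%:C *: a).
Proof.
move=> r0 [pa ia]; split; first exact/posZ/pa/ltW.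
apply: invertibleZ => //.
by rewrite -(rmorph0 (real_complex R)) (inj_eq (@complexI R)); rlra.
Qed.

Lemma pdef1 : pdef e.
Proof. by split; [exact: pos1 | exists e; rewrite !mulr1]. Qed.

Lemma pdef_scalar r : 0 < r -> pdef (r%:C *: e).
Proof. by move=> r0; apply/pdefZ/pdef1. Qed.

Lemma nrm_lt_pdef a r : a = star a -> nrm a < r -> pdef (r%:C *: e - a).
Proof.
move=> sa ar; apply/pdefE; exists (r - nrm a); first by rewrite subr_gt0.
have -> : r%:C *: e - a - (r - nrm a)%:C *: e = (nrm a)%:C *: e - a by alg.
exact: nrm_le_pos.
Qed.

Lemma pdef_shift k x : pdef k -> x = star x ->
  exists2 t0, 0 < t0 & forall t, t0 <= t -> pdef (x + t%:C *: k).
Proof.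
move=> /pdefE [d d0 pk] sx; exists ((nrm x + 1) / d).
  by rewrite divr_gt0 //; have := nrm_ge0 x; rlra.
move=> t; rewrite ler_pdivrMr // => ht.
have -> : x + t%:C *: k = (t * d)%:C *: e - (- x) + t%:C *: (k - d%:C *: e) by alg.
have nx := nrm_ge0 x; apply: pdefDpos.
  apply: nrm_lt_pdef; last by rewrite nrmN; rlra.
  by have := saZ (-1) sx; rewrite rmorphN1 scaleN1r.
by apply: posZ => //; rnra.
Qed.

(** The single test element c = t - b suffices: it gives |t - (b - a)| <= t, the ball form of b - a
    >= 0. *)
Lemma order_char a b : a = star a -> b = star b ->
  (forall c, pdef c -> nrm (a + c) <= nrm (b + c)) -> pos (b - a).
Proof.
move=> sa sb h; pose t : R := nrm b + 1.
have t0 : 0 <= t by have := nrm_ge0 b; rewrite /t; rlra.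
apply: (@nrm_pos _ t); first exact: saB.
have /h : pdef (t%:C *: e - b) by apply: nrm_lt_pdef => //; rewrite /t; rlra.
have -> : b + (t%:C *: e - b) = t%:C *: e by alg.
have -> : a + (t%:C *: e - b) = t%:C *: e - (b - a) by alg.
by move=> /le_trans; apply; apply: nrm_scalar.
Qed.

Lemma pos_inv a b : pos a -> a * b = e -> b * a = e -> pos b.
Proof.
move=> pa ab ba; have sa := pos_sa pa.
apply/positiveE; split; first exact: sa_inv ab ba.
move=> r r0; have ri : r * r^-1 = 1 by rewrite mulfV //; rlra.
have -> : b + r%:C *: e = b * (r%:C *: (a + (r^-1)%:C *: e)).
  have riC : r%:C * (r^-1)%:C = 1 :> R[i] by rewrite -rmorphM ri.
  by rewrite -scaleAr mulrDr ba scalerDr -scaleAr scalerA riC mulr1 scale1r addrC.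
apply: invertibleM; first by exists a.
apply: invertibleZ.
  by rewrite -(rmorph0 (real_complex R)) (inj_eq (@complexI R)); rlra.
by have /positiveE [_] := pa; apply; rewrite invr_gt0.
Qed.

(* [c^* q c + r = c^* (q + r (c c^* )^-1) c] for [c = x + i r] normal and
   invertible; then let [r] tend to [0]. *)
Lemma pos_conj x q : x = star x -> pos q -> pos (x * q * x).
Proof.
move=> sx pq; have sq := pos_sa pq.
have step r : 0 < r -> pos (x * q * x + (r ^+ 2)%:C *: q
    + r%:C *: ('i%C *: (x * q - q * x))).
  move=> r0; pose c := x + r%:C *: ('i%C *: e).
  have [cE cc] := sa_shift_im r sx; rewrite -/c in cE cc.
  have cc' : c * star c = star c * c by rewrite cE /c; alg.
  have pd : pdef (star c * c).
    apply/pdefE; exists (r ^+ 2); first by rewrite exprn_gt0.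
    rewrite cc addrK; have [_ xx] := sa_shift_im 0 sx.
    apply/positiveE; split; first exact: saM.
    (* Squares are positive: x^2 + s^2 = (x - i s)(x + i s), and both factors are invertible. *)
    move=> t t0; have [s st] : exists s : R, t = s ^+ 2 /\ s != 0.
      by exists (Num.sqrt t); rewrite sqr_sqrtr ?(ltW t0) // sqrtr_eq0 -ltNge.
    have [sE ss] := sa_shift_im s sx; rewrite st.1 -ss sE.
    have -> : x - s%:C *: ('i%C *: e) = x - (s%:C * 'i%C) *: e by alg.
    have -> : x + s%:C *: ('i%C *: e) = x - ((- s)%:C * 'i%C) *: e by alg.
    by apply: invertibleM; apply: invertible_sa_sub_im; rewrite ?oppr_eq0 // st.2.
  have [pcc icc] := pd; have [d [ccd dcc]] := icc.
  have ic : invertible (star c).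
    by apply: (@invertible_factor _ _ _ c); rewrite ?cc'.
  have ic' : invertible c.
    by apply: (@invertible_factor _ _ _ (star c)); rewrite ?cc'.
  have pdd : pdef d by split; [exact: pos_inv pcc ccd dcc | exists (star c * c)].
  have -> : x * q * x + (r ^+ 2)%:C *: q + r%:C *: ('i%C *: (x * q - q * x)) =
      star c * q * c.
    rewrite cE /c; have := sqr_i R; move: 'i%C => j hj.
    by alg_scalars; do ?split; ring: hj.
  apply/positiveE; split; first by rewrite !star_mul starK -sq mulrA.
  move=> t t0.
  have -> : star c * q * c + t%:C *: e = star c * (q + t%:C *: d) * c.
    have -> : star c * (q + t%:C *: d) * c =
        star c * q * c + t%:C *: (star c * (d * c)) by move: (star c) (c) => c1 c2; alg.
    congr (_ + _ *: _).
    have dc : d * c = c * d by apply: comm_inv ccd dcc _; rewrite mulrA cc'.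
    by rewrite dc mulrA ccd.
  apply: invertibleM => //; apply: invertibleM => //.
  by rewrite addrC; have [] := pdefDpos (pdefZ t0 pdd) pq.
apply: pos_archimedean; first exact: saMM.
move=> r r0; pose h := 'i%C *: (x * q - q * x).
have sh : h = star h.
  by rewrite /h starZi starB !star_mul -sx -sq; alg.
have q0 := nrm_ge0 q; have h0 := nrm_ge0 h.
(* With s < 1 and s K <= r, the error terms s^2 |q| + s |h| are at most r. *)
pose K := nrm q + nrm h + 1; pose s : R := r / (r + K).
have sK : s * (r + K) = r by rewrite /s; field; rewrite /K; rlra.
have s0 : 0 < s by rewrite divr_gt0 // /K; rlra.
have s1 : s < 1 by rewrite /K in sK; rnra.
have -> : x * q * x + r%:C *: e =
  (x * q * x + (s ^+ 2)%:C *: q + s%:C *: h)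
  + ((s ^+ 2)%:C *: ((nrm q)%:C *: e - q)
  + (s%:C *: ((nrm h)%:C *: e - h)
  + (r - s ^+ 2 * nrm q - s * nrm h)%:C *: e)) by alg.
apply: posD; first exact: step.
apply: posD; first by apply: posZ; [exact: sqr_ge0 | exact: nrm_le_pos].
apply: posD; first by apply: posZ; [exact: ltW | exact: nrm_le_pos].
apply: pos_scalar; have s2 : 0 <= 1 - s by rlra.
have := mulr_ge0 (mulr_ge0 (ltW s0) s2) q0.
by rewrite /K in sK; have := mulr_ge0 (ltW s0) (ltW r0); rlra.
Qed.

End Positive.

(** * Square roots and the Mazur-Ulam argument *)

Section SquareRoot.
Variables (R : realType) (A : unitalCStarAlgType R).
Implicit Types (a : A).

(** From a >= d > 0 and t = |a - d| one gets |(t + d) - a| <= t. Hence a = (t + d)(1 - x) with |x| <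
    1, where [sqrt_exists] applies. *)
Lemma positive_sqrtP a : positive_definite_cone A a ->
  positive_cone A (positive_sqrt a) /\ positive_sqrt a * positive_sqrt a = a.
Proof.
move=> pa; apply: (@xgetPex _ 0 [set s | positive_cone A s /\ s * s = a]).
have /pdefE [d d0 pd] := pa; pose t : R := nrm (a - d%:C *: (1 : A)).
have t0 : 0 <= t := nrm_ge0 _.
have std : (t + d)^-1 * (t + d) = 1 by rewrite mulVf //; rlra.
have i0 : 0 < (t + d)^-1 by rewrite invr_gt0; rlra.
pose x := ((t + d)^-1)%:C *: ((t + d)%:C *: (1 : A) - a).
have sx : x = star x by apply/saZ/saB; [exact/saZ/sa1 | exact: pdef_sa].
have x1 : nrm x < 1.
  rewrite /x nrmZ gtr0_norm //.
  have -> : (t + d)%:C *: (1 : A) - a = t%:C *: (1 : A) - (a - d%:C *: (1 : A)) by alg.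
  by have := pos_nrm pd (lexx _); rewrite -/t; rnra.
have [y [sy y1 yy yc]] := sqrt_exists sx x1.
have ss : Num.sqrt (t + d) * Num.sqrt (t + d) = t + d.
  by rewrite -expr2 sqr_sqrtr //; rlra.
exists ((Num.sqrt (t + d))%:C *: ((1 : A) - y)); split.
  apply: posZ; first exact: sqrtr_ge0.
  have -> : (1 : A) - y = 1%:C *: (1 : A) - y by alg.
  exact/nrm_le_pos/ltW.
rewrite -scaleAl -scaleAr scalerA -rmorphM /= ss yy /x.
have stdC : ((t + d)^-1)%:C * (t + d)%:C = 1 :> R[i] by rewrite -rmorphM std.
move: stdC; move: ((t + d)%:C) (((t + d)^-1)%:C) => p q pq.
by alg_scalars; do ?split; ring: pq.
Qed.

End SquareRoot.

Section MazurUlam.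
Variables (R : realType) (B : unitalCStarAlgType R).
Implicit Types (x y u v : B) (g h : B -> B).

Record sa_isometry u v g h : Prop := SaIsometry {
  isom_sa : forall x, x = star x -> g x = star (g x);
  isom_inv_sa : forall x, x = star x -> h x = star (h x);
  isomK : forall x, x = star x -> h (g x) = x;
  isom_invK : forall x, x = star x -> g (h x) = x;
  isom_dist : forall x y, x = star x -> y = star y -> nrm (g x - g y) = nrm (x - y);
  isom_fixl : g u = u;
  isom_fixr : g v = v }.

(* Vaisala's argument: with [s] the reflection in the midpoint [m], the isometry
   [s h s g] moves [m] twice as far as [g] does. *)
Lemma isometry_fix_midpoint u v g h : u = star u -> v = star v ->
  sa_isometry u v g h -> g ((1/2)%:C *: (u + v)) = (1/2)%:C *: (u + v).
Proof.
move=> su sv gh; set m := _ *: _.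
have sm : m = star m by apply/saZ/saD.
have rsa x : x = star x -> u + v - x = star (u + v - x).
  by move=> sx; apply: saB => //; apply: saD.
have rK x : u + v - (u + v - x) = x by alg.
(* The right-hand side is the same for all isometries fixing [u] and [v], so the doubled
   displacements stay bounded and the original one must vanish. *)
have bound n : forall g h, sa_isometry u v g h ->
    2 ^+ n * nrm (g m - m) <= 2 * nrm (u - m).
  elim: n => [|n IH] {gh}g {}h gh.
    rewrite expr0 mul1r; apply: le_trans (nrm_triangle (g u) _ _) _.
    by rewrite (isom_dist gh) // (isom_fixl gh) nrmBC; rlra.
  case: (gh) => gsa hsa gK hK giso gu gv.
  have hu : h u = u by rewrite -{1}gu gK.
  have hv : h v = v by rewrite -{1}gv gK.
  pose g' x := u + v - h (u + v - g x).
  pose h' x := h (u + v - g (u + v - x)).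
  have gh' : sa_isometry u v g' h'.
    split=> [x sx|x sx|x sx|x sx|x y sx sy||].
    - exact/rsa/hsa/rsa/gsa.
    - exact/hsa/rsa/gsa/rsa.
    - by rewrite /g' /h' rK hK; [rewrite rK gK | apply/rsa/gsa].
    - by rewrite /g' /h' hK; [rewrite rK gK ?rK //; exact: rsa | apply/rsa/gsa/rsa].
    - have -> : g' x - g' y = h (u + v - g y) - h (u + v - g x) by rewrite /g'; alg.
      have hx : u + v - g x = star (u + v - g x) by exact/rsa/gsa.
      have hy : u + v - g y = star (u + v - g y) by exact/rsa/gsa.
      rewrite -(giso _ _ (hsa _ hy) (hsa _ hx)) !hK //.
      have -> : u + v - g y - (u + v - g x) = g x - g y by alg.
      exact: giso.
    - by rewrite /g' gu (addrC u v) addrK hv; alg.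
    - by rewrite /g' gv addrK hu; alg.
  have := IH _ _ gh'; rewrite exprS -mulrA mulrCA.
  suff -> : nrm (g' m - m) = 2 * nrm (g m - m) by [].
  have mE : u + v = m + m by rewrite /m; algf.
  have hm : u + v - g m = star (u + v - g m) by exact/rsa/gsa.
  rewrite -(ger0_norm (ler0n R 2)) -nrmZ.
  have -> : g' m - m = m - h (u + v - g m) by rewrite /g' {1}mE; alg.
  rewrite -(giso _ _ sm (hsa _ hm)).
  by rewrite hK // mE; congr nrm; alg.
apply: subr0_eq; apply: nrm_small_eq0 => r r0.
pose C : R := 2 * nrm (u - m) + 1.
have C0 : 0 < C by have := nrm_ge0 (u - m); rewrite /C; rlra.
have half01 : 0 <= (2^-1 : R) < 1 by apply/andP; split; rlra.
have [n] := expr_small half01 (divr_gt0 r0 C0).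
rewrite ltr_pdivlMr // => hn; have := bound n _ _ gh.
have p0 : 0 < (2^-1 : R) ^+ n by rewrite exprn_gt0 // invr_gt0.
rewrite -(ler_pM2l p0) mulrA -exprMn mulVf ?pnatr_eq0 // expr1n mul1r => h1.
by rewrite /C in hn; rlra.
Qed.

End MazurUlam.

(** * Norm-additive bijections of the positive definite cone *)

Section NormAdditive.
Variables (R : realType) (A B : unitalCStarAlgType R) (T : A -> B).
Implicit Types (a b c d x : A) (y : B) (r t : R).

Local Notation pdefA := (positive_definite_cone A).
Local Notation pdefB := (positive_definite_cone B).
Local Notation posB := (positive_cone B).

Hypothesis T_bij : set_bij pdefA pdefB T.
Hypothesis T_norm : forall a b, pdefA a -> pdefA b -> nrm (T (a + b)) = nrm (T a + T b).
Hypothesis nrm1 : nrm (1 : B) = 1.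

Let T_pdef a : pdefA a -> pdefB (T a).
Proof. by case: T_bij => + _ _; apply. Qed.

Let T_sa a : pdefA a -> T a = star (T a).
Proof. by move=> /T_pdef/pdef_sa. Qed.

Let T_pos a : pdefA a -> posB (T a).
Proof. by move=> /T_pdef/pdef_pos. Qed.

Let T_surj y : pdefB y -> exists2 a, pdefA a & T a = y.
Proof. by case: T_bij => _ _; apply. Qed.

(** Tested against T c: |T a + T c| = |T (a + c)| <= |T (a + c) + T d| = |T (a + d) + T c|. *)
Lemma T_mono a d : pdefA a -> pdefA d -> posB (T (a + d) - T a).
Proof.
move=> pa pd; have pad := pdefD pa pd.
apply: order_char; [exact: T_sa | exact: T_sa |].
move=> _ /T_surj [c pc <-]; have pac := pdefD pa pc.
rewrite -!T_norm // addrAC (T_norm pac pd).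
by apply: nrm_mono; [exact: T_pos | rewrite addrC addKr; exact: T_pos].
Qed.

Lemma T_order a b : pdefA a -> pdefA b ->
  posB (T b - T a) <-> forall c, pdefA c -> nrm (T (a + c)) <= nrm (T (b + c)).
Proof.
move=> pa pb; split=> [h c pc|h].
  rewrite !T_norm //; apply: nrm_mono; first by apply: posD; exact: T_pos.
  by rewrite opprD addrACA subrr addr0.
apply: order_char; [exact: T_sa | exact: T_sa |].
by move=> _ /T_surj [c pc <-]; rewrite -!T_norm //; apply: h.
Qed.

Lemma nrmT_mono a d : pdefA a -> pdefA d -> nrm (T a) <= nrm (T (a + d)).
Proof. by move=> pa pd; apply: nrm_mono; [exact: T_pos | exact: T_mono]. Qed.

Lemma nrmT_le_add a b : pdefA a -> pdefA b -> nrm (T (a + b)) <= nrm (T a) + nrm (T b).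
Proof. by move=> pa pb; rewrite T_norm //; exact: nrmD. Qed.

Lemma nrmT_le_nat n a : pdefA a ->
  nrm (T ((n.+1%:R : R)%:C *: a)) <= n.+1%:R * nrm (T a).
Proof.
move=> pa; elim: n => [|n IH]; first by rewrite scale1r mul1r.
have -> : (n.+2%:R : R)%:C *: a = (n.+1%:R : R)%:C *: a + a.
  by rewrite -[n.+2]addn1 natrD rmorphD /= scalerDl scale1r.
have pn : pdefA ((n.+1%:R : R)%:C *: a) by apply: pdefZ => //; rewrite ltr0n.
apply: le_trans (nrmT_le_add pn pa) _.
by rewrite -[n.+2]addn1 natrD mulrDl mul1r lerD2r.
Qed.

Lemma nrmT_pow2 n a : pdefA a ->
  nrm (T ((2 ^+ n)%:C *: a)) = 2 ^+ n * nrm (T a).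
Proof.
move=> pa; elim: n => [|n IH]; first by rewrite scale1r mul1r.
have -> : (2 ^+ n.+1)%:C *: a = (2 ^+ n)%:C *: a + (2 ^+ n)%:C *: a.
  have -> : (2 ^+ n.+1 : R) = 2 ^+ n + 2 ^+ n by rewrite exprS; ring.
  by alg.
have pn : pdefA ((2 ^+ n)%:C *: a) by apply: pdefZ => //; rewrite exprn_gt0.
rewrite T_norm //.
have -> : T ((2 ^+ n)%:C *: a) + T ((2 ^+ n)%:C *: a) =
    2%:C *: T ((2 ^+ n)%:C *: a) by alg.
by rewrite nrmZ IH ger0_norm // exprS mulrA.
Qed.

(** Doubling is exact, since |T a + T a| = 2 |T a|, whereas other integers only give an upper bound.
    Monotonicity with r <= (m + 1) / 2^n then costs an error of at most |T a| / 2^n. *)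
Lemma nrmT_le_scale r a : 0 < r -> pdefA a -> nrm (T (r%:C *: a)) <= r * nrm (T a).
Proof.
move=> r0 pa; have pra := pdefZ r0 pa.
have na := nrm_ge0 (T a).
apply/ler_addgt0Pr => s s0.
have half01 : 0 <= (2^-1 : R) < 1 by apply/andP; split; rlra.
have n1 : 0 < nrm (T a) + 1 by rlra.
have [n] := expr_small half01 (divr_gt0 s0 n1).
rewrite ltr_pdivlMr // => hn.
have p0 : 0 < (2^-1 : R) ^+ n by rewrite exprn_gt0 // invr_gt0.
have q0 : 0 < (2 : R) ^+ n by rewrite exprn_gt0.
have pq : (2^-1 : R) ^+ n * 2 ^+ n = 1 by rewrite -exprMn mulVf ?pnatr_eq0 // expr1n.
have /andP[_ m1] := truncn_itv (ltW (mulr_gt0 q0 r0)).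
set m := Num.truncn _ in m1.
have pm : pdefA ((m.+1%:R - 2 ^+ n * r)%:C *: a) by apply: pdefZ => //; rewrite subr_gt0.
have pqr : pdefA ((2 ^+ n)%:C *: (r%:C *: a)) by exact: pdefZ.
have := nrmT_mono pqr pm; rewrite nrmT_pow2 //.
have -> : (2 ^+ n)%:C *: (r%:C *: a) + (m.+1%:R - 2 ^+ n * r)%:C *: a =
    (m.+1%:R : R)%:C *: a.
  by move: (2 ^+ n) (m.+1%:R) => u v; alg.
move=> /le_trans /(_ (nrmT_le_nat m pa)).
have /andP[m2 _] := truncn_itv (ltW (mulr_gt0 q0 r0)); rewrite -/m in m2.
rewrite -addn1 natrD -(ler_pM2l p0) mulrA pq mul1r => h.
have : (2^-1) ^+ n * ((m%:R + 1) * nrm (T a)) <=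
       (2^-1) ^+ n * ((2 ^+ n * r + 1) * nrm (T a)).
  by rewrite ler_pM2l //; apply: ler_wpM2r => //; rlra.
have -> : (2^-1) ^+ n * ((2 ^+ n * r + 1) * nrm (T a)) =
  (2^-1 ^+ n * 2 ^+ n) * r * nrm (T a) + 2^-1 ^+ n * nrm (T a) by ring.
rewrite pq; rlra.
Qed.

Lemma nrmT_scale r a : 0 < r -> pdefA a -> nrm (T (r%:C *: a)) = r * nrm (T a).
Proof.
move=> r0 pa; apply/eqP; rewrite eq_le nrmT_le_scale //=.
have ri : r * r^-1 = 1 by rewrite mulfV //; rlra.
have i0 : 0 < r^-1 by rewrite invr_gt0.
have := nrmT_le_scale i0 (pdefZ r0 pa).
by rewrite scalerA -rmorphM /= mulrC ri scale1r -(ler_pM2l r0) mulrA ri mul1r.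
Qed.

Lemma T_order_scale r a b : 0 < r -> pdefA a -> pdefA b ->
  posB (T b - T a) -> posB (T (r%:C *: b) - T (r%:C *: a)).
Proof.
move=> r0 pa pb /(T_order pa pb) h.
apply/T_order; [exact: pdefZ | exact: pdefZ |] => c pc.
have i0 : 0 < r^-1 by rewrite invr_gt0.
have cE : c = r%:C *: ((r^-1)%:C *: c).
  by rewrite scalerA -rmorphM /= mulfV ?scale1r //; rlra.
have pc' := pdefZ i0 pc.
rewrite cE -!scalerDr !nrmT_scale //; try exact: pdefD.
by rewrite ler_pM2l //; apply: h.
Qed.

Lemma T_order_add a b c : pdefA a -> pdefA b -> pdefA c ->
  posB (T b - T a) -> posB (T (b + c) - T (a + c)).
Proof.
move=> pa pb pc /(T_order pa pb) h.
apply/T_order; [exact: pdefD | exact: pdefD |] => d pd.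
by rewrite -!addrA; apply/h/pdefD.
Qed.

(** If n = |y + t|, then y <= n - t, hence |y| <= n - t. This fails in the zero algebra, which is
    why [nrm1] is assumed. *)
Lemma nrm_pos_add_scalar (y : B) t : posB y -> 0 <= t ->
  nrm (y + t%:C *: (1 : B)) = nrm y + t.
Proof.
move=> py t0; apply/eqP; rewrite eq_le; apply/andP; split.
  by apply: le_trans (nrmD _ _) _; rewrite lerD2l nrm_scalar.
set n := nrm (y + _).
have ps : posB (t%:C *: (1 : B)) by exact: pos_scalar.
have tn : t <= n.
  have -> : t = nrm (t%:C *: (1 : B)) by rewrite nrmZ nrm1 mulr1 ger0_norm.
  by apply: nrm_mono => //; rewrite addrK.
rewrite -lerBrDr; apply: posN_nrm; first by rewrite subr_ge0.
  have -> : (n - t)%:C *: (1 : B) - y = n%:C *: (1 : B) - (y + t%:C *: (1 : B)) by alg.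
  by apply: nrm_le_pos => //; apply: saD; exact: pos_sa.
by apply: posD => //; apply: pos_scalar; rewrite subr_ge0.
Qed.

Variable k : A.
Hypothesis k_pdef : pdefA k.
Hypothesis Tk : T k = 1.

(** The norm of T (r k) is r, so T (r k) <= r. Conversely, if T x = r, then T (x / r) has norm 1, so
    it lies below 1 = T k; the order relation is then scaled by r. *)
Lemma T_scale_unit r : 0 < r -> T (r%:C *: k) = r%:C *: (1 : B).
Proof.
move=> r0; have prk := pdefZ r0 k_pdef.
apply/esym/subr0_eq/pos_antisym.
  apply: nrm_le_pos; first exact: T_sa.
  by rewrite nrmT_scale // Tk nrm1 mulr1.
rewrite opprB; have [x px Tx] := T_surj (pdef_scalar B r0).
have i0 : 0 < r^-1 by rewrite invr_gt0.
have px' := pdefZ i0 px.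
have h : posB (T k - T ((r^-1)%:C *: x)).
  rewrite Tk; have -> : (1 : B) = 1%:C *: (1 : B) by rewrite scale1r.
  apply: nrm_le_pos; first exact: T_sa.
  by rewrite nrmT_scale // Tx nrmZ nrm1 mulr1 gtr0_norm // mulVf //; rlra.
have := T_order_scale r0 px' k_pdef h.
by rewrite scalerA -rmorphM /= mulfV ?scale1r ?Tx //; rlra.
Qed.

(** No test element T x separates the two sides: added to either of them it gives the norm |T (c +
    x)| + r. The order test in both directions concludes. *)
Lemma T_shift c r : pdefA c -> 0 < r ->
  T (c + r%:C *: k) = T c + r%:C *: (1 : B).
Proof.
move=> pc r0; have prk := pdefZ r0 k_pdef.
have nE x : pdefA x -> nrm (T (x + r%:C *: k)) = nrm (T x) + r.
  by move=> px; rewrite T_norm // T_scale_unit // nrm_pos_add_scalar ?ltW //; exact: T_pos.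
have sr : T c + r%:C *: (1 : B) = star (T c + r%:C *: (1 : B)).
  by apply: saD; [exact: T_sa | exact/saZ/sa1].
have E x : pdefA x -> nrm (T (c + r%:C *: k) + T x) = nrm (T c + r%:C *: (1 : B) + T x).
  move=> px; rewrite -T_norm //; last exact: pdefD.
  rewrite addrAC nE; last exact: pdefD.
  rewrite [in RHS]addrAC nrm_pos_add_scalar ?ltW //; first by rewrite T_norm.
  by apply: posD; exact: T_pos.
have sT : T (c + r%:C *: k) = star (T (c + r%:C *: k)) by apply/T_sa/pdefD.
apply/subr0_eq/pos_antisym; rewrite ?opprB.
  by apply: order_char => // _ /T_surj [x px <-]; rewrite E.
by apply: order_char => // _ /T_surj [x px <-]; rewrite E.
Qed.

(** Cancelling c amounts to adding t k - c, which is positive definite for large t; [T_shift] then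
    removes t k. *)
Lemma T_order_cancel a b c : pdefA a -> pdefA b -> pdefA c ->
  posB (T (b + c) - T (a + c)) -> posB (T b - T a).
Proof.
move=> pa pb pc h.
have [|t t0 /(_ t (lexx _)) pt] := @pdef_shift _ _ k (- c) k_pdef.
  by have := saZ (-1) (pdef_sa pc); rewrite rmorphN1 scaleN1r.
have := T_order_add (pdefD pa pc) (pdefD pb pc) pt h.
have shift x : x + c + (- c + t%:C *: k) = x + t%:C *: k by alg.
rewrite !shift !T_shift //.
by have -> : T b + t%:C *: (1 : B) - (T a + t%:C *: (1 : B)) = T b - T a by alg.
Qed.

(** The bound T a <= T b + r reads T a <= T (b + r k), a relation between values of T that may be
    translated in both directions. *)
Lemma T_diff_le a b a' b' r : pdefA a -> pdefA b -> pdefA a' -> pdefA b' ->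
  a - b = a' - b' -> 0 < r ->
  posB (r%:C *: (1 : B) - (T a - T b)) -> posB (r%:C *: (1 : B) - (T a' - T b')).
Proof.
move=> pa pb pa' pb' ab r0; have prk := pdefZ r0 k_pdef.
have -> : r%:C *: (1 : B) - (T a - T b) = T b + r%:C *: (1 : B) - T a by alg.
have -> : r%:C *: (1 : B) - (T a' - T b') = T b' + r%:C *: (1 : B) - T a' by alg.
rewrite -!T_shift // => h; apply: (@T_order_cancel _ _ b) => //; first exact: pdefD.
have := T_order_add pa (pdefD pb prk) pb' h.
have -> : a + b' = a' + b.
  transitivity (a - b + (b + b')); first by alg.
  by rewrite ab; alg.
by have -> : b + r%:C *: k + b' = b' + r%:C *: k + b by alg.
Qed.

Lemma T_dist a b a' b' : pdefA a -> pdefA b -> pdefA a' -> pdefA b' ->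
  a - b = a' - b' -> nrm (T a - T b) = nrm (T a' - T b').
Proof.
suff le a0 b0 a1 b1 : pdefA a0 -> pdefA b0 -> pdefA a1 -> pdefA b1 ->
    a0 - b0 = a1 - b1 -> nrm (T a1 - T b1) <= nrm (T a0 - T b0).
  by move=> pa pb pa' pb' ab; apply/eqP; rewrite eq_le !le.
move=> p0 q0 p1 q1 E; apply/ler_addgt0Pr => s s0.
set r := nrm (T a0 - T b0) + s.
have r0 : 0 < r by rewrite /r; have := nrm_ge0 (T a0 - T b0); rlra.
apply: posN_nrm; first exact: ltW.
  apply: T_diff_le E r0 _ => //.
  by apply: nrm_le_pos; [apply: saB; exact: T_sa | rewrite /r; rlra].
have -> : r%:C *: (1 : B) + (T a1 - T b1) = r%:C *: (1 : B) - (T b1 - T a1) by alg.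
have E' : b0 - a0 = b1 - a1 by rewrite -opprB E opprB.
apply: T_diff_le E' r0 _ => //.
by apply: nrm_le_pos; [apply: saB; exact: T_sa | rewrite /r nrmBC; rlra].
Qed.

End NormAdditive.

(** * The linear extension *)

Section LinearExtension.
Variables (R : realType) (A B : unitalCStarAlgType R) (T : A -> B) (k : A).
Implicit Types (a b c x y : A) (u v w : B) (r t : R).

Local Notation pdefA := (positive_definite_cone A).
Local Notation pdefB := (positive_definite_cone B).

Hypothesis T_bij : set_bij pdefA pdefB T.
Hypothesis k_pdef : pdefA k.
Hypothesis T_shift : forall c r, pdefA c -> 0 < r ->
  T (c + r%:C *: k) = T c + r%:C *: (1 : B).
Hypothesis T_dist : forall a b a' b', pdefA a -> pdefA b -> pdefA a' -> pdefA b' ->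
  a - b = a' - b' -> nrm (T a - T b) = nrm (T a' - T b').
Hypothesis nrmT_scale : forall r a, 0 < r -> pdefA a ->
  nrm (T (r%:C *: a)) = r * nrm (T a).
Hypothesis Tk : T k = 1.

(** Every self-adjoint [x] has such a level, so the default 0 concerns other elements only;
    [lin_extE] shows that the choice of level is immaterial. *)
Definition shift_level x : R := xget 0 [set t | pdefA (x + t%:C *: k)].

Definition lin_ext x : B :=
  T (x + (shift_level x)%:C *: k) - (shift_level x)%:C *: (1 : B).

Lemma lin_extE x t : pdefA (x + t%:C *: k) ->
  lin_ext x = T (x + t%:C *: k) - t%:C *: (1 : B).
Proof.
move=> pt; rewrite /lin_ext; set s := shift_level x.
have ps : pdefA (x + s%:C *: k).
  by apply: (@xgetPex _ 0 [set t | pdefA (x + t%:C *: k)]); exists t.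
have step s1 s2 : s1 < s2 -> pdefA (x + s1%:C *: k) ->
    T (x + s1%:C *: k) - s1%:C *: (1 : B) = T (x + s2%:C *: k) - s2%:C *: (1 : B).
  move=> s12 p1; have h : 0 < s2 - s1 by rewrite subr_gt0.
  have -> : x + s2%:C *: k = x + s1%:C *: k + (s2 - s1)%:C *: k by alg.
  by rewrite (T_shift p1 h); alg.
have [st|ts|->//] := ltgtP s t; first exact: step.
by apply/esym/step.
Qed.

Lemma lin_ext_cone a : pdefA a -> lin_ext a = T a.
Proof.
move=> pa; have E : a + (0 : R)%:C *: k = a by rewrite scale0r addr0.
by rewrite (@lin_extE _ 0) E // scale0r subr0.
Qed.

Lemma common_shift x y : x = star x -> y = star y ->
  exists2 t, 0 < t & pdefA (x + t%:C *: k) /\ pdefA (y + t%:C *: k).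
Proof.
move=> sx sy; have [t1 t10 h1] := pdef_shift k_pdef sx.
have [t2 t20 h2] := pdef_shift k_pdef sy.
by exists (t1 + t2); [rlra | split; [apply: h1 | apply: h2]; rlra].
Qed.

Lemma lin_ext_sa x : x = star x -> lin_ext x = star (lin_ext x).
Proof.
move=> sx; have [t t0 [pt _]] := common_shift sx sx.
rewrite (lin_extE pt); apply: saB; last exact/saZ/sa1.
by case: T_bij => h _ _; apply/pdef_sa/h.
Qed.

Lemma lin_ext_inj x y : x = star x -> y = star y -> lin_ext x = lin_ext y -> x = y.
Proof.
move=> sx sy; have [t t0 [px py]] := common_shift sx sy.
rewrite (lin_extE px) (lin_extE py) => /addIr; case: T_bij => _ inj _.
by move=> /inj; rewrite !inE => /(_ px py) /addIr.
Qed.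

Lemma lin_ext_surj u : u = star u -> exists2 x, x = star x & lin_ext x = u.
Proof.
move=> su; pose t : R := nrm u + 1.
have : pdefB (t%:C *: (1 : B) - - u).
  apply: nrm_lt_pdef; last by rewrite nrmN /t; rlra.
  by have := saZ (-1) su; rewrite rmorphN1 scaleN1r.
case: T_bij => _ _ surj /surj [c pc Tc].
exists (c - t%:C *: k).
  by apply: saB; [exact: pdef_sa | exact/saZ/pdef_sa].
have E : c - t%:C *: k + t%:C *: k = c by rewrite subrK.
by rewrite (@lin_extE _ t) E // Tc; alg.
Qed.

Lemma lin_ext_dist x y x' y' : x = star x -> y = star y -> x' = star x' ->
  y' = star y' -> x - y = x' - y' ->
  nrm (lin_ext x - lin_ext y) = nrm (lin_ext x' - lin_ext y').
Proof.
move=> sx sy sx' sy' E.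
have [t _ [px py]] := common_shift sx sy.
have [t' _ [px' py']] := common_shift sx' sy'.
rewrite (lin_extE px) (lin_extE py) (lin_extE px') (lin_extE py').
have cancel u v (s : R) : u - s%:C *: (1 : B) - (v - s%:C *: (1 : B)) = u - v by alg.
rewrite !cancel; apply: T_dist => //.
have -> : x + t%:C *: k - (y + t%:C *: k) = x - y by alg.
by rewrite E; alg.
Qed.

Lemma lin_ext0 : lin_ext 0 = 0.
Proof.
have E : 0 + (1 : R)%:C *: k = k by rewrite add0r scale1r.
by rewrite (@lin_extE _ 1) E // Tk scale1r subrr.
Qed.

Definition lin_inv u : A := xget 0 [set x | x = star x /\ lin_ext x = u].

Lemma lin_invP u : u = star u -> lin_inv u = star (lin_inv u) /\ lin_ext (lin_inv u) = u.
Proof.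
move=> /lin_ext_surj [x sx xu].
by apply: (@xgetPex _ 0 [set x | x = star x /\ lin_ext x = u]); exists x.
Qed.

Lemma lin_extK x : x = star x -> lin_inv (lin_ext x) = x.
Proof.
move=> sx; have [s1 E] := lin_invP (lin_ext_sa sx); exact: lin_ext_inj.
Qed.

(* Mazur-Ulam: conjugating the reflection in the midpoint of [x], [y] by
   [lin_ext] and composing with the reflection in the midpoint of the images
   gives an isometry fixing both images. *)
Lemma lin_ext_midpoint x y : x = star x -> y = star y ->
  lin_ext ((1/2)%:C *: (x + y)) = (1/2)%:C *: (lin_ext x + lin_ext y).
Proof.
move=> sx sy; pose u := lin_ext x; pose v := lin_ext y.
have su : u = star u := lin_ext_sa sx.
have sv : v = star v := lin_ext_sa sy.
have rA z : z = star z -> x + y - z = star (x + y - z).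
  by move=> sz; apply: saB => //; apply: saD.
have rB z : z = star z -> u + v - z = star (u + v - z).
  by move=> sz; apply: saB => //; apply: saD.
have iS z : z = star z -> lin_inv z = star (lin_inv z) by move=> /lin_invP [].
have iK z : z = star z -> lin_ext (lin_inv z) = z by move=> /lin_invP [].
have AK z : x + y - (x + y - z) = z by alg.
have BK z : u + v - (u + v - z) = z by alg.
pose g w := lin_ext (x + y - lin_inv (u + v - w)).
pose h w := u + v - lin_ext (x + y - lin_inv w).
have gh : sa_isometry u v g h.
  split=> [w sw|w sw|w sw|w sw|w z sw sz||].
  - exact/lin_ext_sa/rA/iS/rB.
  - exact/rB/lin_ext_sa/rA/iS.
  - by rewrite /h /g lin_extK ?AK ?iK ?BK //; [exact: rB | exact/rA/iS/rB].
  - by rewrite /h /g BK lin_extK ?AK ?iK //; exact/rA/iS.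
  - rewrite /g; set p := lin_inv (u + v - w); set q := lin_inv (u + v - z).
    have sp : p = star p by exact/iS/rB.
    have sq : q = star q by exact/iS/rB.
    have E : x + y - p - (x + y - q) = q - p by alg.
    rewrite (@lin_ext_dist _ _ q p (rA _ sp) (rA _ sq) sq sp E) !iK; try exact: rB.
    by congr nrm; alg.
  - by rewrite /g (addrC u v) addrK /v lin_extK // addrK.
  - by rewrite /g addrK /u lin_extK // (addrC x y) addrK.
have := isometry_fix_midpoint su sv gh; rewrite /g; set m := _ *: (u + v).
have sm : m = star m by apply/saZ/saD.
have -> : u + v - m = m by rewrite /m; algf.
rewrite -{2}(iK _ sm) => /lin_ext_inj E.
have {}E : x + y - lin_inv m = lin_inv m by apply: E; [exact/rA/iS | exact: iS].
have -> : (1/2)%:C *: (x + y) = lin_inv m.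
  have -> : x + y = lin_inv m + lin_inv m by rewrite -{1}E subrK.
  by algf.
exact: iK.
Qed.

Lemma lin_ext_half x : x = star x -> lin_ext ((1/2)%:C *: x) = (1/2)%:C *: lin_ext x.
Proof.
move=> sx; have s0 : (0 : A) = star 0 by rewrite -[in RHS](subrr x) starB subrr.
by have := lin_ext_midpoint sx s0; rewrite lin_ext0 !addr0.
Qed.

Lemma lin_extD x y : x = star x -> y = star y ->
  lin_ext (x + y) = lin_ext x + lin_ext y.
Proof.
move=> sx sy; have := lin_ext_midpoint sx sy; rewrite lin_ext_half; last exact: saD.
move=> h; have : 2%:C *: ((1/2)%:C *: lin_ext (x + y)) =
  2%:C *: ((1/2)%:C *: (lin_ext x + lin_ext y)) by rewrite h.
rewrite !scalerA -rmorphM /=; have -> : 2 * (1/2) = 1 :> R by rlra.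
by rewrite !scale1r.
Qed.

Lemma lin_extN x : x = star x -> lin_ext (- x) = - lin_ext x.
Proof.
move=> sx; have sN : - x = star (- x).
  by have := saZ (-1) sx; rewrite rmorphN1 scaleN1r.
by apply/eqP; rewrite -addr_eq0 -lin_extD // addNr lin_ext0.
Qed.

Lemma lin_ext_nat n x : x = star x ->
  lin_ext ((n%:R : R)%:C *: x) = (n%:R : R)%:C *: lin_ext x.
Proof.
move=> sx; elim: n => [|n IH]; first by rewrite !scale0r lin_ext0.
rewrite -addn1 natrD rmorphD !scalerDl !scale1r lin_extD ?IH //.
exact: saZ.
Qed.

(** Additivity settles integer multiples. Multiplying the defect by N leaves only the fractional
    part q of N r, whose defect is at most 2 |T a|; then N is taken large. *)
Lemma lin_ext_scale_cone r a : 0 < r -> pdefA a ->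
  lin_ext (r%:C *: a) = r%:C *: lin_ext a.
Proof.
move=> r0 pa; apply: subr0_eq; apply: nrm_small_eq0 => s s0.
have sa := pdef_sa pa; have n0 := nrm_ge0 (T a).
pose n := Num.truncn ((2 * nrm (T a)) / s).
have hn : 2 * nrm (T a) < n.+1%:R * s.
  rewrite -ltr_pdivrMr //.
  by have /andP[] := @truncn_itv _ ((2 * nrm (T a)) / s) ltac:(by rewrite divr_ge0 //; rlra).
have N0 : 0 < n.+1%:R :> R by rewrite ltr0n.
set N : R := n.+1%:R in hn N0.
have /andP[m1 m2] := truncn_itv (ltW (mulr_gt0 N0 r0)).
set m := Num.truncn (N * r) in m1 m2.
rewrite -(ler_pM2l N0) -[X in X * nrm _](ger0_norm (ltW N0)) -nrmZ.
have -> : N%:C *: (lin_ext (r%:C *: a) - r%:C *: lin_ext a) =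
    lin_ext ((N * r - m%:R)%:C *: a) - (N * r - m%:R)%:C *: lin_ext a.
  have e1 : N%:C *: lin_ext (r%:C *: a) = lin_ext ((N * r)%:C *: a).
    by rewrite -lin_ext_nat; [rewrite scalerA -rmorphM | exact: saZ].
  have e2 : lin_ext ((N * r - m%:R)%:C *: a) =
      lin_ext ((N * r)%:C *: a) - (m%:R : R)%:C *: lin_ext a.
    rewrite rmorphB scalerBl lin_extD; [|exact: saZ|].
      by rewrite lin_extN ?lin_ext_nat //; exact: saZ.
    by have := saZ (-1) (saZ m%:R sa); rewrite rmorphN1 scaleN1r.
  by rewrite scalerBr e1 e2; alg.
set q := N * r - m%:R.
have q0 : 0 <= q by rewrite subr_ge0.
have q1 : q <= 1 by move: m2; rewrite -addn1 natrD /q; rlra.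
have hq : nrm (lin_ext (q%:C *: a)) <= nrm (T a).
  move: q0; rewrite le_eqVlt => /orP[/eqP <-|q0].
    by rewrite scale0r lin_ext0 nrm0.
  by rewrite lin_ext_cone ?nrmT_scale //; [rnra | exact: pdefZ].
apply: le_trans (nrmD _ _) _; rewrite nrmN nrmZ ger0_norm // (lin_ext_cone pa).
by have := ler_piMl n0 q1; rlra.
Qed.

Lemma lin_ext_scale r x : x = star x -> lin_ext (r%:C *: x) = r%:C *: lin_ext x.
Proof.
move=> sx; wlog r0 : r / 0 < r.
  move=> H; have [r0|r0|->] := ltgtP r 0; last by rewrite !scale0r lin_ext0.
    have := H (- r); rewrite oppr_gt0 => /(_ r0).
    rewrite rmorphN !scaleNr lin_extN; last exact: saZ.
    exact: oppr_inj.
  exact: H.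
have [t t0 [pt _]] := common_shift sx sx.
have pk := pdefZ t0 k_pdef.
have -> : r%:C *: x = r%:C *: (x + t%:C *: k) - r%:C *: (t%:C *: k) by alg.
have sk : r%:C *: (t%:C *: k) = star (r%:C *: (t%:C *: k)) by exact/saZ/pdef_sa.
rewrite lin_extD; [|exact/saZ/pdef_sa|]; last first.
  by have := saZ (-1) sk; rewrite rmorphN1 scaleN1r.
rewrite lin_extN // (lin_ext_scale_cone r0 pk) (lin_ext_scale_cone r0 pt) lin_extD;
  [|done|exact: pdef_sa].
by rewrite scalerDr addrK.
Qed.

End LinearExtension.

(** * Kadison's theorem on unital order isomorphisms *)

Section Kadison.
Variables (R : realType).

(** Linearity is demanded on self-adjoint elements only, where the extension of T is controlled. *)
Record unital_positive (A B : unitalCStarAlgType R) (f : A -> B) : Prop :=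
  UnitalPositive {
  up_sa : forall x, x = star x -> f x = star (f x);
  upD : forall x y, x = star x -> y = star y -> f (x + y) = f x + f y;
  upZ : forall (r : R) x, x = star x -> f (r%:C *: x) = r%:C *: f x;
  up1 : f 1 = 1;
  up_pos : forall x, positive_cone A x -> positive_cone B (f x) }.

(** * Bernstein polynomials of an element between 0 and 1 *)

Section BernsteinWalk.
Variable A : unitalCStarAlgType R.
Implicit Types a p : A.
Local Notation pos := (positive_cone A).

(** Positivity of products is available only in the form x q x. Recording p times 1, a, 1 - a and a
    (1 - a) covers all parities of the two exponents: a further factor permutes these conditions up
    to a conjugation. *)
Definition walk_weight a p :=
  [/\ p * a = a * p, pos p, pos (p * a), pos (p * (1 - a)) & pos (p * a * (1 - a))].

Lemma walk_weight1 a : pos a -> pos (1 - a) -> walk_weight a 1.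
Proof.
move=> pa pa1; split; rewrite ?mul1r ?mulr1 //; first exact: pos1.
have -> : a * (1 - a) = a * (1 - a) * a + (1 - a) * a * (1 - a) by alg.
by apply: posD; apply: pos_conj => //; exact: pos_sa.
Qed.

Lemma walk_weight_up a p : pos a -> walk_weight a p -> walk_weight a (p * a).
Proof.
move=> /pos_sa sa [pa p0 p1 p2 p3]; split=> //.
- by rewrite mulrA -pa.
- by rewrite pa; exact: pos_conj.
- have -> : p * a * a * (1 - a) = a * (p * (1 - a)) * a.
    by rewrite pa; alg_scalars; do ?split; ring.
  exact: pos_conj.
Qed.

Lemma walk_weight_down a p : pos (1 - a) -> walk_weight a p -> walk_weight a (p * (1 - a)).
Proof.
move=> /pos_sa sa [pa p0 p1 p2 p3].
have pc : p * (1 - a) = (1 - a) * p by rewrite mulrBr mulrBl pa mulr1 mul1r.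
split=> //.
- have -> : p * (1 - a) * a = p * a * (1 - a) by alg.
  by rewrite mulrA -pa.
- by have -> : p * (1 - a) * a = p * a * (1 - a) by alg.
- by rewrite {1}pc; exact: pos_conj.
- have -> : p * (1 - a) * a * (1 - a) = (1 - a) * (p * a) * (1 - a).
    by rewrite pc -!mulrA.
  exact: pos_conj.
Qed.

(* The pairs [(l, a^l (1 - a)^(n - l))], each occurring [binomial n l] times:
   the Bernstein polynomials of [a]. *)
Fixpoint walk a n : seq (nat * A) :=
  if n is n'.+1 then
    [seq (x.1.+1, x.2 * a) | x <- walk a n'] ++ [seq (x.1, x.2 * (1 - a)) | x <- walk a n']
  else [:: (0%N, 1)].

Lemma walk_weightP a n x : pos a -> pos (1 - a) -> x \in walk a n -> walk_weight a x.2.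
Proof.
move=> pa pa1; elim: n x => [|n IH] x /=.
  by rewrite inE => /eqP ->; exact: walk_weight1.
rewrite mem_cat => /orP[] /mapP [y /IH hy ->]; first exact: walk_weight_up.
exact: walk_weight_down.
Qed.

Local Notation nat_scal l := ((l%:R : R)%:C).

(** This and the next two lemmas are the moments of order 0, 1 and 2 of the binomial distribution
    with parameter [a]. *)
Lemma walk_sum0 a n : \sum_(x <- walk a n) x.2 = 1.
Proof.
elim: n => [|n IH] /=; first by rewrite big_seq1.
rewrite big_cat !big_map /= -!mulr_suml IH; alg.
Qed.

Lemma walk_sum1 a n : \sum_(x <- walk a n) nat_scal x.1 *: x.2 = nat_scal n *: a.
Proof.
elim: n => [|n IH] /=; first by rewrite big_seq1 !scale0r.
rewrite big_cat !big_map /=.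
under eq_bigr => x _ do rewrite -addn1 natrD rmorphD scalerDl scale1r scaleAl.
under [X in _ + X]eq_bigr => x _ do rewrite scaleAl.
rewrite big_split /= -!mulr_suml IH walk_sum0 -addn1 natrD.
by alg.
Qed.

Lemma walk_sum2 a n : \sum_(x <- walk a n) (nat_scal x.1 * nat_scal x.1) *: x.2 =
  (nat_scal n * nat_scal n - nat_scal n) *: (a * a) + nat_scal n *: a.
Proof.
elim: n => [|n IH] /=; first by rewrite big_seq1 !(scale0r, mul0r, subr0, addr0).
rewrite big_cat !big_map /=.
have up x : (nat_scal x.1.+1 * nat_scal x.1.+1) *: (x.2 * a) =
    (nat_scal x.1 * nat_scal x.1) *: x.2 * a +
    (2%:C *: (nat_scal x.1 *: x.2 * a) + x.2 * a) :> A.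
  by rewrite -addn1 natrD; move: (x.1%:R) x.2 => l p; alg.
under eq_bigr => x _ do rewrite up.
under [X in _ + X]eq_bigr => x _ do rewrite scaleAl.
rewrite !big_split /= -scaler_sumr -!mulr_suml IH walk_sum0 walk_sum1.
have -> : (n.+1%:R : R) = n%:R + 1 by rewrite -addn1 natrD.
by move: (n%:R) => l; alg.
Qed.

End BernsteinWalk.

(** * The inequality f(a)^2 <= f(a^2) for unital positive maps *)

Section Inequality.
Variables (A B : unitalCStarAlgType R) (f : A -> B).
Hypothesis f_up : unital_positive f.
Implicit Types a : A.

Lemma up0 : f 0 = 0.
Proof. by have := upZ f_up 0 (@sa1 R A); rewrite !scale0r. Qed.

Lemma upN x : x = star x -> f (- x) = - f x.
Proof. by move=> sx; have := upZ f_up (-1) sx; rewrite rmorphN1 !scaleN1r. Qed.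

Lemma upB x y : x = star x -> y = star y -> f (x - y) = f x - f y.
Proof.
move=> sx sy; rewrite (upD f_up) ?upN //.
by have := saZ (-1) sy; rewrite rmorphN1 scaleN1r.
Qed.

Lemma up_sum (I : eqType) (s : seq I) (F : I -> A) :
  (forall i, i \in s -> F i = star (F i)) ->
  \sum_(i <- s) F i = star (\sum_(i <- s) F i) /\
  f (\sum_(i <- s) F i) = \sum_(i <- s) f (F i).
Proof.
elim: s => [|i s IH] h.
  rewrite !big_nil up0; split=> //.
  by rewrite -[in RHS](subrr (1 : A)) starB subrr.
rewrite !big_cons; have [|sS fS] := IH; first by move=> j js; apply: h; rewrite inE js orbT.
have sF : F i = star (F i) by apply: h; rewrite inE eqxx.
by split; [exact: saD | rewrite (upD f_up) // fS].
Qed.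

Lemma pos_sum (I : eqType) (s : seq I) (F : I -> B) :
  (forall i, i \in s -> positive_cone B (F i)) -> positive_cone B (\sum_(i <- s) F i).
Proof.
elim: s => [|i s IH] h.
  by rewrite big_nil; have := @pos_scalar R B 0 (lexx 0); rewrite scale0r.
rewrite big_cons; apply: posD; first by apply: h; rewrite inE eqxx.
by apply: IH => j js; apply: h; rewrite inE js orbT.
Qed.

(* With [b = f a], [sum (l - n b) f(p_l) (l - n b) >= 0] expands to
   [n (n - 1) f (a^2) + n f a - n^2 b^2]; divide by [n^2]. *)
Lemma kadison_inequality a : positive_cone A a -> positive_cone A (1 - a) ->
  positive_cone B (f (a * a) - f a * f a).
Proof.
move=> pa pa1; have sa := pos_sa pa; have saa := saM sa sa erefl.
set b := f a; have sb : b = star b by exact: up_sa.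
have sfa : f (a * a) = star (f (a * a)) by exact: up_sa.
have bound n : positive_cone B
    ((n%:R * n%:R : R)%:C *: (f (a * a) - b * b) + (n%:R : R)%:C *: (b - f (a * a))).
  pose N := (n%:R : R)%:C; pose nb := N *: b.
  have snb : nb = star nb by exact: saZ.
  have w x : x \in walk a n -> positive_cone A x.2.
    by move=> /walk_weightP [].
  have ws x : x \in walk a n -> x.2 = star x.2 by move=> /w/pos_sa.
  have term x : x \in walk a n -> positive_cone B
      (((x.1%:R : R)%:C *: (1 : B) - nb) * f x.2 * ((x.1%:R : R)%:C *: (1 : B) - nb)).
    move=> xw; apply: pos_conj; first by apply: saB => //; exact/saZ/sa1.
    exact/(up_pos f_up)/w.
  have e0 : \sum_(x <- walk a n) f x.2 = 1.
    by rewrite -(up_sum ws).2 walk_sum0 (up1 f_up).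
  have e1 : \sum_(x <- walk a n) (x.1%:R : R)%:C *: f x.2 = nb.
    have h x : x \in walk a n -> (x.1%:R : R)%:C *: x.2 = star ((x.1%:R : R)%:C *: x.2).
      by move=> /ws; exact: saZ.
    have := (up_sum h).2; rewrite walk_sum1 (upZ f_up) // -/b -/N -/nb => ->.
    by apply: eq_big_seq => x /ws sx; rewrite (upZ f_up).
  have e2 : \sum_(x <- walk a n) ((x.1%:R : R)%:C * (x.1%:R : R)%:C) *: f x.2 =
      (N * N - N) *: f (a * a) + N *: b.
    have h x : x \in walk a n -> ((x.1%:R * x.1%:R : R))%:C *: x.2 =
        star (((x.1%:R * x.1%:R : R))%:C *: x.2).
      by move=> /ws; exact: saZ.
    have := (up_sum h).2.
    under eq_bigr => x _ do rewrite rmorphM /=.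
    rewrite walk_sum2 /N -rmorphM -rmorphB (upD f_up) ?(upZ f_up) //; try exact: saZ.
    move=> ->; apply: eq_big_seq => x /ws sx.
    by rewrite -rmorphM (upZ f_up).
  have := pos_sum term.
  have E x : ((x.1%:R : R)%:C *: (1 : B) - nb) * f x.2 * ((x.1%:R : R)%:C *: (1 : B) - nb) =
     ((x.1%:R : R)%:C * (x.1%:R : R)%:C) *: f x.2
     - ((x.1%:R : R)%:C *: f x.2 * nb + nb * ((x.1%:R : R)%:C *: f x.2) - nb * f x.2 * nb).
    by alg.
  under eq_bigr => x _ do rewrite E.
  rewrite big_split /= sumrN big_split /= big_split /= sumrN.
  rewrite -!mulr_suml -!mulr_sumr e0 e1 e2 /nb /N.
  rewrite rmorphM /=; move: ((n%:R : R)%:C) => M.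
  set lhs := (X in positive_cone B X -> _); set rhs := (X in _ -> positive_cone B X).
  by have -> : lhs = rhs by rewrite /lhs /rhs; alg.
apply: pos_archimedean; first by apply: saB => //; apply: saM.
move=> r r0; set c := b - f (a * a).
have sc : c = star c by exact: saB.
(* Large enough that c / n <= r, which absorbs the remainder of [bound] after division by n^2. *)
pose n := (Num.truncn (nrm c / r)).+1; pose N : R := n%:R.
have N0 : 0 < N by rewrite ltr0n.
have hN : nrm c <= N * r.
  rewrite -ler_pdivrMr //; apply: ltW.
  by have /andP[] := @truncn_itv _ (nrm c / r) ltac:(by rewrite divr_ge0 ?nrm_ge0 // ltW).
have Ni : N^-1 * N = 1 by rewrite mulVf //; rlra.
have i0 : 0 <= N^-1 by rewrite invr_ge0 ltW.
have NiC : (N^-1)%:C * N%:C = 1 :> R[i] by rewrite -rmorphM Ni.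
have -> : f (a * a) - b * b + r%:C *: (1 : B) =
   (N^-1 * N^-1)%:C *: ((N * N)%:C *: (f (a * a) - b * b) + N%:C *: c)
   + (N^-1)%:C *: ((N * r)%:C *: (1 : B) - c).
  rewrite !rmorphM /=; move: NiC; move: (N^-1%:C) (N%:C) => p q pq.
  by alg_scalars; do ?split; ring: pq.
apply: posD; first by apply: posZ; [exact: mulr_ge0 | exact: bound].
by apply: posZ => //; apply: nrm_le_pos.
Qed.

End Inequality.

Lemma unital_positive_inverse (A B : unitalCStarAlgType R) (f : A -> B) (g : B -> A) :
  unital_positive f ->
  (forall x, x = star x -> positive_cone B (f x) -> positive_cone A x) ->
  (forall y, y = star y -> g y = star (g y)) ->
  (forall x, x = star x -> g (f x) = x) -> (forall y, y = star y -> f (g y) = y) ->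
  unital_positive g.
Proof.
move=> f_up f_refl gS fK gK.
have s1 : (1 : A) = star 1 by exact: sa1.
split=> // [x y sx sy|r x sx||x px].
- have h : g x + g y = star (g x + g y) by apply: saD; exact: gS.
  by rewrite -[RHS]fK // (upD f_up) ?gK //; exact: gS.
- have h : r%:C *: g x = star (r%:C *: g x) by apply/saZ/gS.
  by rewrite -[RHS]fK // (upZ f_up) ?gK //; exact: gS.
- by rewrite -(up1 f_up) fK.
- have sx := pos_sa px; apply: f_refl; first exact: gS.
  by rewrite gK.
Qed.

Lemma kadison_square (A B : unitalCStarAlgType R) (f : A -> B) (g : B -> A) :
  unital_positive f -> unital_positive g ->
  (forall x, x = star x -> g (f x) = x) -> (forall y, y = star y -> f (g y) = y) ->
  forall a, a = star a -> f (a * a) = f a * f a.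
Proof.
move=> f_up g_up fK gK.
have unit_case a : positive_cone A a -> positive_cone A (1 - a) -> f (a * a) = f a * f a.
  move=> pa pa1; have sa := pos_sa pa; have saa := saM sa sa erefl.
  have s1 : (1 : A) = star 1 by exact: sa1.
  have pb := up_pos f_up pa.
  have pb1 : positive_cone B (1 - f a).
    by rewrite -(up1 f_up) -(upB f_up) //; exact: up_pos.
  have sb := pos_sa pb; have sbb := saM sb sb erefl.
  apply/subr0_eq/pos_antisym; first exact: kadison_inequality.
  rewrite opprB.
  (* The inequality for [g] at f a says a^2 <= g (f(a)^2); applying the positive map [f] gives
     f(a^2) <= f(a)^2. *)
  have := up_pos f_up (kadison_inequality g_up pb pb1).
  by rewrite fK // (upB f_up) ?gK //; exact: (up_sa g_up).
move=> a sa; pose n : R := nrm a + 1.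
have n0 : 0 < n by rewrite /n; have := nrm_ge0 a; rlra.
have sN : - a = star (- a) by have := saZ (-1) sa; rewrite rmorphN1 scaleN1r.
have i0 : 0 <= (2 * n)^-1 by rewrite invr_ge0; rlra.
(* The affine change c = (n + a) / (2 n) moves [a] between 0 and 1, and [f] respects it, being
   linear and unital. The added 1 keeps [n] nonzero when a = 0. *)
pose c := ((2 * n)^-1)%:C *: (n%:C *: (1 : A) - - a).
have pc : positive_cone A c.
  by apply/posZ/nrm_le_pos => //; rewrite nrmN /n; rlra.
have nz : n%:C != 0 :> R[i] by rewrite fmorph_eq0; rlra.
have pc1 : positive_cone A (1 - c).
  have -> : 1 - c = ((2 * n)^-1)%:C *: (n%:C *: (1 : A) - a).
    by rewrite /c; move: (n) nz => m mz; alg_scalars; do ?split; field; exact: mz.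
  by apply/posZ/nrm_le_pos => //; rewrite /n; rlra.
have s1 : (1 : A) = star 1 by exact: sa1.
have sc := pos_sa pc; have scc := saM sc sc erefl.
have aE : a = (2 * n)%:C *: c - n%:C *: (1 : A).
  by rewrite /c; move: (n) nz => m mz; alg_scalars; do ?split; field; exact: mz.
have aaE : a * a = (4 * n * n)%:C *: (c * c) - ((4 * n * n)%:C *: c - (n * n)%:C *: (1 : A)).
  by rewrite aE; alg.
have h1 : f a = (2 * n)%:C *: f c - n%:C *: (1 : B).
  rewrite {1}aE (upB f_up (saZ (2 * n) sc) (saZ n s1)).
  by rewrite (upZ f_up _ sc) (upZ f_up _ s1) (up1 f_up).
have s2 := saZ (4 * n * n) sc; have s3 := saZ (n * n) s1.
rewrite aaE (upB f_up (saZ _ scc) (saB s2 s3)) (upB f_up s2 s3).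
rewrite (upZ f_up _ scc) (upZ f_up _ sc) (upZ f_up _ s1) (up1 f_up).
by rewrite unit_case // h1; alg.
Qed.

(** * Complex-linear extension to a Jordan isomorphism *)

Section Complexification.
Variables (A B : unitalCStarAlgType R) (f : A -> B) (g : B -> A).
Hypotheses (f_up : unital_positive f) (g_up : unital_positive g).
Hypothesis fK : forall x, x = star x -> g (f x) = x.
Hypothesis gK : forall y, y = star y -> f (g y) = y.

Definition re_part (C : unitalCStarAlgType R) (a : C) : C := (1/2)%:C *: (a + star a).
Definition im_part (C : unitalCStarAlgType R) (a : C) : C :=
  (1/2)%:C *: ('i%C *: (star a - a)).

Lemma re_sa (C : unitalCStarAlgType R) (a : C) : re_part a = star (re_part a).
Proof. by rewrite /re_part starZr starD starK addrC. Qed.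

Lemma im_sa (C : unitalCStarAlgType R) (a : C) : im_part a = star (im_part a).
Proof. by rewrite /im_part starZr starZi starB starK; alg. Qed.

Lemma re_imE (C : unitalCStarAlgType R) (a : C) : a = re_part a + 'i%C *: im_part a.
Proof.
rewrite /re_part /im_part; have := sqr_i R; move: 'i%C => j hj.
by alg_scalars; do ?split; field: hj.
Qed.

Lemma re_im_unique (C : unitalCStarAlgType R) (a u v : C) : u = star u -> v = star v ->
  a = u + 'i%C *: v -> re_part a = u /\ im_part a = v.
Proof.
move=> su sv ->; rewrite /re_part /im_part starD starZi -su -sv.
have := sqr_i R; move: 'i%C => j hj.
by split; alg_scalars; do ?split; field: hj.
Qed.

Definition complexify (C D : unitalCStarAlgType R) (h : C -> D) (a : C) : D :=
  h (re_part a) + 'i%C *: h (im_part a).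

Lemma complexifyE (C D : unitalCStarAlgType R) (h : C -> D) (a u v : C) :
  u = star u -> v = star v -> a = u + 'i%C *: v ->
  complexify h a = h u + 'i%C *: h v.
Proof. by move=> su sv /(re_im_unique su sv) [E1 E2]; rewrite /complexify E1 E2. Qed.

Lemma complexifyK (C D : unitalCStarAlgType R) (h : C -> D) (k : D -> C) :
  (forall x, x = star x -> h x = star (h x)) ->
  (forall x, x = star x -> k (h x) = x) -> cancel (complexify h) (complexify k).
Proof.
move=> hS hK a; rewrite (@complexifyE _ _ k _ (h (re_part a)) (h (im_part a))) //.
- by rewrite !hK -?re_imE //; [exact: im_sa | exact: re_sa].
- exact/hS/re_sa.
- exact/hS/im_sa.
Qed.

Lemma complexify_jordan : jordan_star_isomorphism (complexify f).
Proof.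
have cE := @complexifyE A B f.
split.
- move=> l a b; set u := re_part a; set v := im_part a.
  set u' := re_part b; set v' := im_part b.
  have [su sv] : u = star u /\ v = star v by split; [exact: re_sa | exact: im_sa].
  have [su' sv'] : u' = star u' /\ v' = star v' by split; [exact: re_sa | exact: im_sa].
  pose p := complex.Re l; pose q := complex.Im l.
  have lE : l = p%:C + 'i%C * q%:C by exact: complexE.
  have E : l *: a + b = (p%:C *: u - q%:C *: v + u') + 'i%C *: (p%:C *: v + q%:C *: u + v').
    rewrite {1}lE {1}(re_imE a) {1}(re_imE b) -/u -/v -/u' -/v'.
    by have := sqr_i R; move: 'i%C => j hj; alg_scalars; do ?split; ring: hj.
  have s1 := saZ p su; have s2 := saZ q sv; have s3 := saZ p sv; have s4 := saZ q su.
  have s12 := saB s1 s2; have s34 := saD s3 s4.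
  rewrite (cE _ _ _ (saD s12 su') (saD s34 sv') E).
  rewrite (cE a u v su sv (re_imE a)) (cE b u' v' su' sv' (re_imE b)).
  rewrite (upD f_up s12 su') (upD f_up s34 sv') (upB f_up s1 s2) (upD f_up s3 s4).
  rewrite (upZ f_up p su) (upZ f_up q sv) (upZ f_up p sv) (upZ f_up q su) lE.
  by have := sqr_i R; move: 'i%C => j hj; alg_scalars; do ?split; ring: hj.
- exists (complexify g); apply: complexifyK => //; [exact: up_sa f_up | exact: up_sa g_up].
- move=> a; set u := re_part a; set v := im_part a.
  have [su sv] : u = star u /\ v = star v by split; [exact: re_sa | exact: im_sa].
  have suv := saD su sv.
  have sq := kadison_square f_up g_up fK gK.
  have suu := saM su su erefl; have svv := saM sv sv erefl.
  have sw := saM suv suv erefl.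
  (* Polarization: u v + v u is expressed by squares of self-adjoint elements, which [f]
     preserves. *)
  have E : a ^+ 2 = (u * u - v * v) + 'i%C *: ((u + v) * (u + v) - (u * u + v * v)).
    rewrite expr2 {1 2}(re_imE a) -/u -/v.
    by have := sqr_i R; move: 'i%C => j hj; alg_scalars; do ?split; ring: hj.
  rewrite (cE _ _ _ (saB suu svv) (saB sw (saD suu svv)) E).
  rewrite (cE a u v su sv (re_imE a)) (upB f_up suu svv) (upB f_up sw (saD suu svv)).
  rewrite (upD f_up suu svv) !sq // (upD f_up su sv) expr2.
  by have := sqr_i R; move: 'i%C => j hj; alg_scalars; do ?split; ring: hj.
- move=> a; set u := re_part a; set v := im_part a.
  have [su sv] : u = star u /\ v = star v by split; [exact: re_sa | exact: im_sa].
  have sN : - v = star (- v) by have := saZ (-1) sv; rewrite rmorphN1 scaleN1r.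
  have E : star a = u + 'i%C *: (- v).
    by rewrite {1}(re_imE a) -/u -/v starD starZi -su -sv; alg.
  rewrite (cE _ _ _ su sN E) (cE a u v su sv (re_imE a)) (upN f_up sv).
  by rewrite starD starZi -(up_sa f_up su) -(up_sa f_up sv); alg.
Qed.

End Complexification.

End Kadison.

(** * The characterization *)

Section MainDirection.
Variables (R : realType) (A B : unitalCStarAlgType R) (T : A -> B).

Local Notation pdefA := (positive_definite_cone A).
Local Notation pdefB := (positive_definite_cone B).

Hypothesis T_bij : set_bij pdefA pdefB T.

Lemma nrm1_cases : (1 : B) = 0 \/ nrm (1 : B) = 1.
Proof.
have := nrm_sa (@sa1 R B); rewrite mulr1 expr2 => h.
have [/nrm_eq0|n0] := eqVneq (nrm (1 : B)) 0; first by left.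
by right; apply: (mulfI n0); rewrite mulr1 -h.
Qed.

(** The elements 1 and 1 + 1 of the cone have the same image, so injectivity identifies them. *)
Lemma trivial_domain : (1 : B) = 0 -> (1 : A) = 0.
Proof.
move=> B0; have all0 (y : B) : y = 0 by rewrite -[y]mulr1 B0 mulr0.
have p2 : pdefA (1 + 1) by apply: pdefD; exact: pdef1.
have [_ inj _] := T_bij; have p1 := @pdef1 R A.
have : (1 : A) = 1 + 1.
  by apply: inj; rewrite ?inE // (all0 (T 1)) (all0 (T (1 + 1))).
by rewrite -{1}[1]addr0 => /addrI <-.
Qed.

Hypothesis T_norm : forall a b, pdefA a -> pdefA b -> nrm (T (a + b)) = nrm (T a + T b).

Lemma norm_additive_jordan : exists J : A -> B, jordan_star_isomorphism J /\
  forall a, pdefA a -> T a = positive_sqrt (T 1) * J a * positive_sqrt (T 1).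
Proof.
have [B0|nrm1] := nrm1_cases.
  have A0 := trivial_domain B0.
  have allA (x : A) : x = 0 by rewrite -[x]mulr1 A0 mulr0.
  have allB (y : B) : y = 0 by rewrite -[y]mulr1 B0 mulr0.
  exists (fun=> 0); split; last by move=> a _; rewrite (allB (T a)) [RHS]allB.
  split=> [l a b||a|a]; try by rewrite [RHS]allB.
  by exists (fun=> 0) => z; [rewrite [RHS]allA | rewrite [RHS]allB].
have [_ _ T_surj] := T_bij; have [T_pdef _ _] := T_bij.
have [k pk Tk] := T_surj _ (@pdef1 R B).
have shift c r pc r0 := @T_shift R A B T T_bij T_norm nrm1 k pk Tk c r pc r0.
have dist a b a' b' := @T_dist R A B T T_bij T_norm nrm1 k pk Tk a b a' b'.
have scal r a := @nrmT_scale R A B T T_bij T_norm r a.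
pose F := lin_ext T k; pose G := lin_inv T k.
have FT : forall a, pdefA a -> F a = T a := lin_ext_cone shift.
have FS : forall x, x = star x -> F x = star (F x) := lin_ext_sa T_bij pk shift.
have FD : forall x y, x = star x -> y = star y -> F (x + y) = F x + F y :=
  lin_extD T_bij pk shift dist Tk.
have FZ : forall r x, x = star x -> F (r%:C *: x) = r%:C *: F x :=
  lin_ext_scale T_bij pk shift dist scal Tk.
have GP : forall y, y = star y -> G y = star (G y) /\ F (G y) = y := lin_invP T_bij pk shift.
have FK : forall x, x = star x -> G (F x) = x := lin_extK T_bij pk shift.
have sk := pdef_sa pk.
have Fk r x : x = star x -> F (x + r%:C *: k) = F x + r%:C *: (1 : B).
  by move=> sx; rewrite FD ?FZ ?(FT k) ?Tk //; exact: saZ.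
have skr r : r%:C *: k = star (r%:C *: k) by exact: saZ.
(* The archimedean property with [k] as order unit: k <= |k|, so small multiples of [k] lie below
   small scalars. *)
have pos_k x : (forall r, 0 < r -> positive_cone A (x + r%:C *: k)) -> x = star x ->
    positive_cone A x.
  move=> h sx; apply: pos_archimedean => // r r0.
  have n0 := nrm_ge0 k; pose s := r / (nrm k + 1).
  have s0 : 0 < s by rewrite divr_gt0 //; rlra.
  have rs : r = s * (nrm k + 1) by rewrite /s mulrVK // unitfE; rlra.
  have -> : x + r%:C *: (1 : A) = x + s%:C *: k + (s%:C *: ((nrm k)%:C *: (1 : A) - k)
      + s%:C *: (1 : A)) by rewrite rs; move: (s) => s'; alg.
  apply: posD; first exact: h.
  apply: posD; last exact/pos_scalar/ltW.
  by apply: posZ; [exact: ltW | exact: nrm_le_pos].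
have F_pos x : positive_cone A x -> positive_cone B (F x).
  move=> px; have sx := pos_sa px; apply: pos_archimedean; first exact: FS.
  move=> r r0; rewrite -Fk //.
  have pr : pdefA (x + r%:C *: k) by rewrite addrC; apply: pdefDpos => //; exact: pdefZ.
  by rewrite FT //; apply/pdef_pos/T_pdef.
(* F x + r = F (x + r k) is positive definite, hence equals T d = F d for some [d] in the cone;
   injectivity of F gives x + r k = d. *)
have F_refl x : x = star x -> positive_cone B (F x) -> positive_cone A x.
  move=> sx pF; apply: pos_k => // r r0.
  have : pdefB (F x + r%:C *: (1 : B)) by rewrite addrC; apply: pdefDpos => //; exact: pdef_scalar.
  move=> /T_surj [d pd]; rewrite -FT // -Fk // => /(congr1 G).
  rewrite !FK; [|exact: saD|exact: pdef_sa].
  by move=> <-; exact: pdef_pos.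
have pT1 : pdefB (T 1) by apply/T_pdef/pdef1.
set s := positive_sqrt (T 1); have [ps ss] := positive_sqrtP pT1; rewrite -/s in ps ss.
have ss' := pos_sa ps.
have [c [sc cs]] : invertible s.
  by apply: (@invertible_factor _ _ s s) => //; rewrite ss; case: pT1.
have sc' : c = star c by exact: sa_inv sc cs.
pose f x := c * F x * c; pose g y := G (s * y * s).
have f_up : unital_positive f.
  split.
  - by move=> x /FS h; exact: saMM.
  - by move=> x y sx sy; rewrite /f FD //; alg.
  - by move=> r x sx; rewrite /f FZ //; alg.
  - by rewrite /f (FT _ (@pdef1 R A)) -ss mulrA cs mul1r sc.
  - by move=> x /F_pos h; exact: pos_conj.
have csC y : c * (s * y * s) * c = y by rewrite !mulrA cs mul1r -mulrA sc mulr1.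
have scC y : s * (c * y * c) * s = y by rewrite !mulrA sc mul1r -mulrA cs mulr1.
have gS y : y = star y -> g y = star (g y).
  by move=> sy; case: (GP (s * y * s)) => //; exact: saMM.
have fK x : x = star x -> g (f x) = x by move=> sx; rewrite /g /f scC FK.
have gK y : y = star y -> f (g y) = y.
  by move=> sy; rewrite /f /g (GP _ _).2 ?csC //; exact: saMM.
have f_refl x : x = star x -> positive_cone B (f x) -> positive_cone A x.
  move=> sx pf; apply: F_refl => //; rewrite -(scC (F x)).
  by apply: pos_conj.
have g_up := unital_positive_inverse f_up f_refl gS fK gK.
exists (complexify f); split; first exact: complexify_jordan f_up g_up fK gK.
move=> a pa; have sa := pdef_sa pa.
have s0 : (0 : A) = star 0 by rewrite -[in RHS](subrr (1 : A)) starB subrr.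
have E : a = a + 'i%C *: 0 by rewrite scaler0 addr0.
by rewrite (complexifyE _ sa s0 E) (up0 f_up) scaler0 addr0 /f scC FT.
Qed.

End MainDirection.

Theorem corollary2p3 (R : realType) (A B : unitalCStarAlgType R) (T : A -> B)
    (hT : set_bij (positive_definite_cone A) (positive_definite_cone B) T) :
  (forall a b : A, positive_definite_cone A a -> positive_definite_cone A b ->
     `|T (a + b)| = `|T a + T b|)
  <->
  (exists J : A -> B, jordan_star_isomorphism J /\
     forall a : A, positive_definite_cone A a ->
       T a = positive_sqrt (T 1) * J a * positive_sqrt (T 1)).
Proof.
split=> [h|[J [[Jlin _ _ _] JT]] a b pa pb].
  by apply: norm_additive_jordan => // a b pa pb; rewrite /nrm h.
rewrite (JT _ (pdefD pa pb)) (JT _ pa) (JT _ pb).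
have -> : J (a + b) = J a + J b by have := Jlin 1 a b; rewrite !scale1r.
by rewrite mulrDr mulrDl.
Qed.
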